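(* Let $G$ be a connected affine algebraic group with Lie algebra $\mathfrak g$, let $V$ be a finite-dimensional rational $G$-module with moment mapping $\mu:V\times V^*\to\mathfrak g^*$, and let $\hat\psi:\mathrm{Mor}(V,V^* )\to\mathrm{Mor}(V,\mathfrak g^* )$ be given by $\hat\psi(F)(v)=\mu(v,F(v))$. Set $\Omega_\psi=V_{reg}$ and $$E'_\psi=\{(v,\xi)\in\Omega_\psi\times V^*\mid\mu(v,\xi)=0\}=\{(v,\xi)\in\Omega_\psi\times V^*\mid\xi\in(\mathfrak g\cdot v)^\perp\},$$ a vector bundle on $\Omega_\psi$. Suppose $E'_\psi$ is a trivial vector bundle and $\mathrm{codim}(V\setminus\Omega_\psi)\ge3$. Then $$\mathrm{Im}\,\hat\psi=\{\mathcal F\in\mathrm{Mor}(V,\mathfrak g^* )\mid\mathcal F(v)\in\mu(v,V^* )\ \ \forall v\in V\}.$$ In other words, if $\mathcal F\in\mathrm{Mor}(V,\mathfrak g^* )$ satisfies $\mathcal F(v)\in\mu(v,V^* )$ for all $v\in\Omega_\psi$, then there is $F\in\mathrm{Mor}(V,V^* )$ such that $\mathcal F(v)=\mu(v,F(v))$ for all $v\in V$.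
   Context: The base field $\Bbbk$ is algebraically closed of characteristic $0$. $\mathrm{Mor}(V,N)$ is the $\Bbbk[V]$-module of polynomial morphisms $V\to N$ between finite-dimensional vector spaces. The moment mapping is defined by $\langle\mu(v,\eta),x\rangle=\langle x\cdot v,\eta\rangle$ for $v\in V$, $\eta\in V^*$, $x\in\mathfrak g$, and $\mu(v,V^* )=\{\mu(v,\eta)\mid\eta\in V^*\}$. $V_{reg}$ is the dense open set of $v\in V$ with $\dim G\cdot v$ maximal (equivalently, $\dim\mathfrak g\cdot v$ maximal, where $\mathfrak g\cdot v=\{x\cdot v\mid x\in\mathfrak g\}$). $(\cdot)^\perp$ denotes the annihilator in $V^*$. The empty set has codimension $\infty$. Triviality of $E'_\psi$ is as an algebraic vector bundle on $\Omega_\psi$. *)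

(* Defs.v *)
From HB Require Import structures.
From mathcomp Require Import all_boot all_order all_algebra.
From mathcomp Require Import mpoly.
From Stdlib Require Import Classical ClassicalEpsilon.

Set Implicit Arguments.
Unset Strict Implicit.
Unset Printing Implicit Defensive.

Import GRing.Theory.
Local Open Scope ring_scope.

(* A finite-dimensional vector space is viewed as an affine space through the
   coordinates in a fixed basis; the resulting polynomial maps, closed sets and
   differentials do not depend on the basis. *)

Section AffineSpaces.
Variable k : fieldType.

Definition coords (V : vectType k) (v : V) : 'I_(\dim {:V}) -> k :=
  fun i => coord (vbasis {:V}) i v.

Definition polyfun (V : vectType k) := {mpoly k[\dim {:V}]}.

Definition peval (V : vectType k) (f : polyfun V) (v : V) : k := f.@[coords v].

Definition pdiff (V : vectType k) (f : polyfun V) (v x : V) : k :=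
  \sum_i (mderiv i f).@[coords v] * coords x i.

(* Polynomial maps V -> N, given by their coordinate polynomials. *)
Definition polymap (V N : vectType k) := 'I_(\dim {:N}) -> polyfun V.

Definition mapeval (V N : vectType k) (P : polymap V N) (v : V) : N :=
  \sum_i peval (P i) v *: (vbasis {:N})`_i.

(* mapdiff P v x is the differential of P at v, applied to x. *)
Definition mapdiff (V N : vectType k) (P : polymap V N) (v x : V) : N :=
  \sum_i pdiff (P i) v x *: (vbasis {:N})`_i.

Definition Mor (V N : vectType k) (F : V -> N) : Prop :=
  exists P : polymap V N, forall v, F v = mapeval P v.

(* Morphisms from a Zariski closed set X of an affine space to an affine
   space are the restrictions of polynomial maps. *)
Definition closed_morphism (V N : vectType k) (X : V -> Prop) (F : V -> N) :=
  exists P : polymap V N, forall v, X v -> F v = mapeval P v.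

(* Morphisms from a locally closed set to an affine space: maps that are
   locally quotients of polynomials. *)
Definition regular_on (V N : vectType k) (X : V -> Prop) (F : V -> N) :=
  forall x, X x -> exists (P : polymap V N) (q : polyfun V),
    peval q x != 0 /\
    forall y, X y -> peval q y != 0 -> F y = (peval q y)^-1 *: mapeval P y.

(* Zariski topology *)

Definition zclosed (V : vectType k) (X : V -> Prop) : Prop :=
  exists I : polyfun V -> Prop,
    forall v, X v <-> (forall f, I f -> peval f v = 0).

Definition rel_closed (V : vectType k) (X Y : V -> Prop) : Prop :=
  exists2 C : V -> Prop, zclosed C & forall v, Y v <-> X v /\ C v.

Definition subset (V : Type) (A B : V -> Prop) := forall v, A v -> B v.

Definition irreducible (V : vectType k) (Y : V -> Prop) : Prop :=
  (exists v, Y v) /\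
  forall A B : V -> Prop, zclosed A -> zclosed B ->
    (forall v, Y v -> A v \/ B v) -> subset Y A \/ subset Y B.

Definition zconnected (V : vectType k) (X : V -> Prop) : Prop :=
  (exists v, X v) /\
  forall A B : V -> Prop, zclosed A -> zclosed B ->
    (forall v, X v -> A v \/ B v) -> (forall v, X v -> ~ (A v /\ B v)) ->
    subset X A \/ subset X B.

(* A chain Y 0 < Y 1 < ... < Y d of irreducible closed subsets of the
   space X (with the induced topology). *)
Definition irr_chain (V : vectType k) (X : V -> Prop) (d : nat)
    (Y : nat -> V -> Prop) : Prop :=
  (forall i, (i <= d)%N -> rel_closed X (Y i) /\ irreducible (Y i)) /\
  (forall i, (i < d)%N -> subset (Y i) (Y i.+1) /\ ~ subset (Y i.+1) (Y i)).

(* Krull dimension at least d *)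
Definition dim_ge (V : vectType k) (X : V -> Prop) (d : nat) : Prop :=
  exists Y, irr_chain X d Y.

(* dim X1 <= dim X2 *)
Definition dim_le (V : vectType k) (X1 X2 : V -> Prop) : Prop :=
  forall d, dim_ge X1 d -> dim_ge X2 d.

(* codim(Z) >= c for a closed subset Z of X: the codimension of Z is the
   infimum, over the irreducible closed subsets Y of Z, of the supremum of the
   lengths of the chains of irreducible closed subsets of X starting at Y.
   In particular, the empty set has codimension oo. *)
Definition codim_ge (V : vectType k) (X Z : V -> Prop) (c : nat) : Prop :=
  forall Y : V -> Prop, rel_closed X Y -> irreducible Y -> subset Y Z ->
    exists2 C, irr_chain X c C & forall v, C 0%N v <-> Y v.

(* E is a family of subspaces of N parametrized by Omega, as a subset of
   V * N; the pair (Phi, Psi) is an isomorphism Omega x k^r -> E of varieties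
   over Omega that is linear on the fibres. *)
Definition trivial_bundle (V N : vectType k) (Omega : V -> Prop)
    (E : V * N -> Prop) : Prop :=
  exists (r : nat) (Phi : V * 'rV[k]_r -> N) (Psi : V * N -> 'rV[k]_r),
    [/\ regular_on (fun p => Omega p.1) Phi,
        regular_on E Psi,
        forall v, Omega v -> linear (fun c => Phi (v, c)),
        forall v c, Omega v -> E (v, Phi (v, c)) /\ Psi (v, Phi (v, c)) = c
      & forall v xi, E (v, xi) -> Phi (v, Psi (v, xi)) = xi].

End AffineSpaces.

Section LinearPredicates.
Variables (k : fieldType) (W : vectType k) (P : W -> Prop).
Hypotheses (P0 : P 0) (PD : forall a x y, P x -> P y -> P (a *: x + y)).

Lemma vspace_of_exists : exists U : {vspace W}, forall x, x \in U <-> P x.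
Proof.
suff ext n (U : {vspace W}) : (\dim {:W} - \dim U <= n)%N ->
    (forall x, x \in U -> P x) -> exists U : {vspace W}, forall x, x \in U <-> P x.
  apply: (ext (\dim {:W}) 0%VS); first exact: leq_subr.
  by move=> x; rewrite memv0 => /eqP->.
elim: n U => [|n IHn] U dimU UP.
  exists U => x; split=> [/UP//|_].
  have /eqP-> : (U == fullv)%VS by rewrite eqEdim subvf -subn_eq0 -leqn0.
  exact: memvf.
case: (classic (forall x, P x -> x \in U)) => [PU|].
  by exists U => x; split; [exact: UP | exact: PU].
move=> /not_all_ex_not[x nPU]; have [Px xU] := imply_to_and _ _ nPU.
apply: (IHn (U + <[x]>)%VS) => [|y /memv_addP[u uU [w /vlineP[a ->] ->]]].
  have ltU : (\dim U < \dim (U + <[x]>))%N.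
    rewrite ltnNge; apply/negP => le_dim; apply: xU.
    have /eqP-> : (U == U + <[x]>)%VS by rewrite eqEdim addvSl.
    by rewrite (subvP (addvSr _ _)) ?memv_line.
  by rewrite -ltnS (leq_trans _ dimU)// ltn_sub2l// (leq_trans ltU)// dimvS ?subvf.
by rewrite addrC; apply: PD => //; apply: UP.
Qed.

End LinearPredicates.

Section AlgebraicGroups.
Variable k : fieldType.

(* Affine algebraic groups: Zariski closed sets in an affine space W with a
   group structure given by morphisms. *)
Record affAlgGroup (W : vectType k) := AffAlgGroup {
  ag_set :> W -> Prop;
  ag_one : W;
  ag_mul : W -> W -> W;
  ag_inv : W -> W;
  ag_closed : zclosed ag_set;
  ag_mul_mor : closed_morphism (fun p : W * W => ag_set p.1 /\ ag_set p.2)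
                               (fun p => ag_mul p.1 p.2);
  ag_inv_mor : closed_morphism ag_set ag_inv;
  ag_one_in : ag_set ag_one;
  ag_mul_in : forall g h, ag_set g -> ag_set h -> ag_set (ag_mul g h);
  ag_inv_in : forall g, ag_set g -> ag_set (ag_inv g);
  ag_mulA : forall g h l, ag_set g -> ag_set h -> ag_set l ->
    ag_mul g (ag_mul h l) = ag_mul (ag_mul g h) l;
  ag_mul1 : forall g, ag_set g -> ag_mul ag_one g = g;
  ag_mulV : forall g, ag_set g -> ag_mul (ag_inv g) g = ag_one
}.

Definition ag_connected (W : vectType k) (G : affAlgGroup W) : Prop :=
  zconnected G.

(* The Lie algebra as a vector space: the Zariski tangent space of G at the
   identity, defined by the full vanishing ideal of G. *)
Definition tangent1 (W : vectType k) (G : affAlgGroup W) (x : W) : Prop :=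
  forall f : polyfun W, (forall g, G g -> peval f g = 0) ->
    pdiff f (ag_one G) x = 0.

Lemma pdiff_linear (W : vectType k) (f : polyfun W) v : linear (pdiff f v : W -> k^o).
Proof.
move=> a x y; rewrite /pdiff scaler_sumr -big_split /=; apply: eq_bigr => i _.
by rewrite /coords linearP /= mulrDr; congr (_ + _); rewrite mulrCA.
Qed.

Lemma lieAlg_exists (W : vectType k) (G : affAlgGroup W) :
  exists U : {vspace W}, forall x, x \in U <-> tangent1 G x.
Proof.
apply: vspace_of_exists => [f f0|a x y Px Py f f0].
  by rewrite /pdiff big1// => i _; rewrite /coords linear0 mulr0.
by rewrite (pdiff_linear f) (Px f f0) (Py f f0) scaler0 addr0.
Qed.

Definition lieAlg (W : vectType k) (G : affAlgGroup W) : {vspace W} :=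
  proj1_sig (constructive_indefinite_description _ (lieAlg_exists G)).

Lemma lieAlgP (W : vectType k) (G : affAlgGroup W) x :
  x \in lieAlg G <-> tangent1 G x.
Proof. by rewrite /lieAlg; case: constructive_indefinite_description. Qed.

Local Notation lie_type G := (subvs_of (lieAlg G)).

Local Notation dual V := 'Hom(V, k^o).

(* Rational G-modules: homomorphisms of algebraic groups G -> GL(V). The
   representation is recorded by a polynomial map W -> End(V), of which only
   the restriction to G is relevant. *)
Record ratModule (W : vectType k) (G : affAlgGroup W) (V : vectType k) :=
  RatModule {
    rm_map : polymap W 'End(V);
    rm_one : mapeval rm_map (ag_one G) = \1%VF;
    rm_mul : forall g h, G g -> G h ->
      mapeval rm_map (ag_mul G g h) =
        (mapeval rm_map g \o mapeval rm_map h)%VF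
  }.

Section Modules.
Variables (W : vectType k) (G : affAlgGroup W) (V : vectType k).
Variable rho : ratModule G V.

Definition gact (g : W) (v : V) : V := mapeval (rm_map rho) g v.

(* x . v for x in the Lie algebra, through the differential at the identity;
   as x is tangent to G, this depends only on the restriction to G of the
   polynomial map. *)
Definition lact (x : lie_type G) (v : V) : V :=
  mapdiff (rm_map rho) (ag_one G) (vsval x) v.

Definition orbit (v w : V) : Prop := exists2 g, G g & w = gact g v.

(* v lies in V_reg when the dimension of G . v is maximal. *)
Definition Vreg (v : V) : Prop := forall w, dim_le (orbit w) (orbit v).

Definition mu (v : V) (eta : dual V) : dual (lie_type G) :=
  linfun (fun x : lie_type G => eta (lact x v)).

Definition in_mu (v : V) (l : dual (lie_type G)) : Prop :=
  exists eta : dual V, l = mu v eta.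

Definition psi_hat (F : V -> dual V) : V -> dual (lie_type G) :=
  fun v => mu v (F v).

Definition Epsi (p : V * dual V) : Prop := Vreg p.1 /\ mu p.1 p.2 = 0.

Lemma lact_linear v : linear (lact^~ v).
Proof.
move=> a x y; rewrite /lact /mapdiff !sum_lfunE scaler_sumr -big_split /=.
apply: eq_bigr => i _; rewrite (pdiff_linear _ _ a) !scale_lfunE.
by rewrite scalerDl scalerA.
Qed.

Lemma muE v eta x : mu v eta x = eta (lact x v).
Proof.
have lin : linear (fun x : lie_type G => eta (lact x v)).
  by move=> a y z; rewrite lact_linear linearP.
pose B := GRing.isLinear.Build k (lie_type G) k^o *:%R _ lin.
pose L : {linear lie_type G -> k^o} :=
  HB.pack (fun x : lie_type G => eta (lact x v)) B.
exact: (lfunE L).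
Qed.

(* The fibre of Epsi at v is the annihilator of g . v in the dual of V. *)
Lemma EpsiP v xi :
  Epsi (v, xi) <-> Vreg v /\ forall x : lie_type G, xi (lact x v) = 0.
Proof.
split=> -[vreg xi0]; split=> //; first by move=> x; rewrite -muE xi0 zero_lfunE.
by apply/lfunP => x; rewrite muE xi0 zero_lfunE.
Qed.

End Modules.

End AlgebraicGroups.

Notation lie_type G := (subvs_of (lieAlg G)).
Notation dual V := 'Hom(V, _^o).

(* Main.v *)
(* Write A = k[V] and choose coordinates, so that mu becomes a matrix M over A
   and a global frame of E'_psi a matrix B whose rows, by Hartogs' extension,
   are polynomial; at each point of Omega = V_reg the rows of B(v) are a basis
   of the kernel of M(v), hence M has constant rank on Omega.  The denominators
   a such that a calF = F_a M for some polynomial F_a form an ideal, and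
   Cramer's rule shows that its zeros lie outside Omega.

   Since codim (V \ Omega) >= 3, this ideal contains a regular sequence a, b, d.
   The differences b F_a - a F_b are syzygies of M, so they come from a cocycle g
   with values in the trivial bundle: b F_a - a F_b = g B.  The cocycle relation
   gives d g = 0 modulo (a, b), hence g = a e + b e'; correcting F_a and F_b by
   e' B and e B makes them glue to a polynomial solution F.  This is the vanishing
   of H^1(Omega, O), made explicit.

   The regular sequence comes from elimination: an ideal whose zero set has
   codimension at least 3 contains a nonzero polynomial in any given n - 2
   elements of A.  Otherwise it lies in a prime ideal avoiding those polynomials;
   by the Nullstellensatz a chain of irreducible closed sets above its zero set
   is a chain of primes, whose length exceeds the available transcendence
   degree.  In generic linear coordinates, three such eliminations give elements
   monic in the last variable, monic in the one before and free of both. *)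
From HB Require Import structures.
Require Import Defs.
From mathcomp Require Import all_boot all_order all_algebra.
From mathcomp Require Import mpoly ring.
From mathcomp Require classical_sets.
From Stdlib Require Import Classical ClassicalEpsilon.

Set Implicit Arguments.
Unset Strict Implicit.
Unset Printing Implicit Defensive.

Import GRing.Theory.
Local Open Scope ring_scope.

Local Notation widen := (widen_ord (leqnSn _)).

(** * Multivariate polynomials as iterated univariate ones *)

Lemma mpoly_rmorph_ext n (R : comNzRingType) (S : comNzRingType)
    (phi psi : {rmorphism {mpoly R[n]} -> S}) :
  (forall c, phi c%:MP = psi c%:MP) -> (forall i, phi 'X_i = psi 'X_i) ->
  phi =1 psi.
Proof.
move=> eqC eqX p; rewrite (mpolyE p) !rmorph_sum; apply: eq_bigr => m _.
rewrite -mul_mpolyC !rmorphM /= eqC mpolyXE_id !rmorph_prod.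
by congr (_ * _); apply: eq_bigr => i _; rewrite !rmorphXn /= eqX.
Qed.

Lemma muni_widen n (R : comNzRingType) (i : 'I_n) :
  muni ('X_(widen i) : {mpoly R[n.+1]}) = ('X_i)%:P.
Proof.
rewrite /muni mmapX mmap1U; case: splitP => [j /= eq|j].
  by congr ('X__)%:P; apply/val_inj=> /=; rewrite -eq.
by rewrite ord1 /= addn0 => /eqP /=; rewrite ltn_eqF.
Qed.

Lemma muni_ord_max n (R : comNzRingType) :
  muni ('X_ord_max : {mpoly R[n.+1]}) = 'X.
Proof.
rewrite /muni mmapX mmap1U; case: splitP => //; case=> j lt_jn /eqP /=.
by have := lt_jn; rewrite ltn_neqAle eq_sym=> /andP[/negbTE->].
Qed.

Lemma ord_widen_ind n (P : 'I_n.+1 -> Prop) :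
  P ord_max -> (forall i : 'I_n, P (widen i)) -> forall i, P i.
Proof.
move=> Pmax Pw i; case: (unliftP ord_max i) => [j ->|->//].
have <- : widen j = lift ord_max j by apply/val_inj; rewrite /= /bump leqNgt ltn_ord.
exact: Pw.
Qed.

(** Both sides are ring morphisms in [p], so comparing them on constants and variables suffices. *)
Lemma mmap_muni n (R S : comNzRingType) (f : {rmorphism R -> S})
    (h : 'I_n.+1 -> S) p :
  mmap f h p = (map_poly (mmap f (fun i => h (widen i))) (muni p)).[h ord_max].
Proof.
pose g : {rmorphism {mpoly R[n.+1]} -> S} :=
  horner_eval (h ord_max) \o map_poly (mmap f (fun i => h (widen i))) \o @muni n R.
suff : mmap f h =1 g by move=> ->.
apply: mpoly_rmorph_ext => [c|].
  by rewrite /= /horner_eval muniC map_polyC /= hornerC !mmapC.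
apply: ord_widen_ind => [|i]; rewrite /= /horner_eval ?muni_ord_max ?muni_widen.
  by rewrite map_polyX hornerX mmapX mmap1U.
by rewrite map_polyC hornerC /= !mmapX !mmap1U.
Qed.

(** Left inverse of [muni]. As a ring morphism it pulls primes of [{mpoly R[n.+1]}] back to [{poly
    {mpoly R[n]}}]. *)
Definition mjoin n (R : comNzRingType) (q : {poly {mpoly R[n]}}) : {mpoly R[n.+1]} :=
  (map_poly (@mwiden n R) q).['X_ord_max].

HB.instance Definition _ n (R : comNzRingType) :=
  GRing.RMorphism.copy (@mjoin n R)
    (horner_eval ('X_ord_max : {mpoly R[n.+1]}) \o map_poly (@mwiden n R)).

Lemma mjoinC n (R : comNzRingType) (c : {mpoly R[n]}) : mjoin c%:P = mwiden c.
Proof. by rewrite /mjoin map_polyC hornerC. Qed.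

Lemma muniK n (R : comNzRingType) : cancel (@muni n R) (@mjoin n R).
Proof.
move=> p; suff : @mjoin n R \o @muni n R =1 idfun by move=> /(_ p).
apply: mpoly_rmorph_ext => [c|] /=; first by rewrite muniC mjoinC mwidenC.
apply: ord_widen_ind => [|i]; rewrite ?muni_ord_max ?muni_widen /mjoin.
  by rewrite map_polyX hornerX.
by rewrite map_polyC hornerC /= mwidenX mnmwiden1.
Qed.

Lemma muni_eq0 n (R : comNzRingType) (p : {mpoly R[n.+1]}) :
  (muni p == 0) = (p == 0).
Proof. by rewrite -(inj_eq (can_inj (@muniK n R))) muni0. Qed.

Lemma mevalE_muni n (R : comNzRingType) (v : 'I_n.+1 -> R) p :
  p.@[v] = (map_poly (meval (fun i => v (widen i))) (muni p)).[v ord_max].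
Proof. exact: mmap_muni. Qed.

(** The appended coordinate sits at [ord_max], the variable that [muni] singles out. *)
Definition point_rcons n (T : Type) (w : 'I_n -> T) (t : T) (i : 'I_n.+1) : T :=
  if unlift ord_max i is Some j then w j else t.

Lemma point_rcons_max n (T : Type) (w : 'I_n -> T) (t : T) :
  point_rcons w t ord_max = t.
Proof. by rewrite /point_rcons unlift_none. Qed.

Lemma point_rcons_widen n (T : Type) (w : 'I_n -> T) (t : T) i :
  point_rcons w t (widen i) = w i.
Proof.
rewrite /point_rcons.
have -> : widen i = lift ord_max i by apply/val_inj; rewrite /= /bump leqNgt ltn_ord.
by rewrite liftK.
Qed.

Lemma meval_point_rcons n (R : comNzRingType) (w : 'I_n -> R) t p :
  p.@[point_rcons w t] = (map_poly (meval w) (muni p)).[t].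
Proof.
rewrite mevalE_muni point_rcons_max; congr (_.[_]).
by apply: eq_map_poly => q /=; apply: meval_eq => i; rewrite point_rcons_widen.
Qed.

(** Induction on [n]: at a point where the leading coefficient in the last variable does not vanish,
    a nonzero univariate polynomial remains, and it has a nonroot. *)
Lemma mpoly_neq0P (k : closedFieldType) n (p : {mpoly k[n]}) :
  p != 0 -> exists v, p.@[v] != 0.
Proof.
elim: n p => [|n IHn] p nz_p.
  exists (fun _ => 0); rewrite (nvar0_mpolyC p) mevalC.
  by apply: contraNneq nz_p => p0; rewrite (nvar0_mpolyC p) p0 mpolyC0.
have nz_up : muni p != 0 by rewrite muni_eq0.
have [v nz_v] : exists v, (lead_coef (muni p)).@[v] != 0.
  by apply: IHn; rewrite lead_coef_eq0.
have /closed_nonrootP[t nz_t] : map_poly (meval v) (muni p) != 0.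
  rewrite -lead_coef_eq0 lead_coef_map_eq //.
by exists (point_rcons v t); rewrite meval_point_rcons.
Qed.

Lemma mpoly_meval_inj (k : closedFieldType) n (p q : {mpoly k[n]}) :
  (forall v, p.@[v] = q.@[v]) -> p = q.
Proof.
move=> eq_pq; apply/eqP; rewrite -subr_eq0; apply/negPn/negP => /mpoly_neq0P[v].
by rewrite mevalB eq_pq subrr eqxx.
Qed.

(** * Prime ideals and the Nullstellensatz *)

Definition is_ideal (A : comNzRingType) (I : A -> Prop) : Prop :=
  [/\ I 0, forall x y, I x -> I y -> I (x + y) & forall a x, I x -> I (a * x)].

Definition is_prime (A : comNzRingType) (P : A -> Prop) : Prop :=
  [/\ is_ideal P, ~ P 1 & forall x y, P (x * y) -> P x \/ P y].

Section IdealTheory.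
Variables (A : comNzRingType) (I : A -> Prop).
Hypothesis idI : is_ideal I.

Lemma ideal0 : I 0. Proof. by case: idI. Qed.
Lemma idealD x y : I x -> I y -> I (x + y). Proof. by case: idI => _ h _; apply: h. Qed.
Lemma idealMl a x : I x -> I (a * x). Proof. by case: idI => _ _; apply. Qed.
Lemma idealMr a x : I x -> I (x * a). Proof. by rewrite mulrC; apply: idealMl. Qed.
Lemma idealN x : I x -> I (- x). Proof. by rewrite -mulN1r; apply: idealMl. Qed.
Lemma idealB x y : I x -> I y -> I (x - y).
Proof. by move=> Ix Iy; apply/idealD/idealN. Qed.
Lemma ideal_sum (J : Type) (r : seq J) (P : pred J) F :
  (forall i, P i -> I (F i)) -> I (\sum_(i <- r | P i) F i).
Proof. by move=> IF; elim/big_rec: _ => [|i x Pi Ix]; [exact: ideal0 | apply: idealD; auto]. Qed.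

End IdealTheory.

Lemma primeX (A : comNzRingType) (P : A -> Prop) x n :
  is_prime P -> P (x ^+ n) -> P x.
Proof.
case=> _ P1 PM; elim: n => [|n IHn]; first by rewrite expr0 => /P1.
by rewrite exprS => /PM[].
Qed.

Lemma prime_comap (A B : comNzRingType) (f : {rmorphism A -> B}) (P : B -> Prop) :
  is_prime P -> is_prime (fun x => P (f x)).
Proof.
case=> idP P1 PM; split; last by move=> x y; rewrite rmorphM; apply: PM.
  split; first by rewrite rmorph0; apply: ideal0.
  - by move=> x y Px Py; rewrite rmorphD; apply: idealD.
  - by move=> a x Px; rewrite rmorphM; apply: idealMl.
by rewrite rmorph1.
Qed.

Definition ideal_add1 (A : comNzRingType) (I : A -> Prop) (f x : A) : Prop :=
  exists u w, I u /\ x = u + w * f.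

Lemma ideal_add1P (A : comNzRingType) (I : A -> Prop) f :
  is_ideal I -> [/\ is_ideal (ideal_add1 I f), forall x, I x -> ideal_add1 I f x
                  & ideal_add1 I f f].
Proof.
move=> idI; split; last 2 first.
- by move=> x Ix; exists x, 0; rewrite mul0r addr0.
- by exists 0, 1; rewrite mul1r add0r; split=> //; exact: ideal0.
split.
- by exists 0, 0; rewrite mul0r addr0; split=> //; exact: ideal0.
- move=> _ _ [u [w [Iu ->]]] [u' [w' [Iu' ->]]]; exists (u + u'), (w + w').
  by split; [exact: idealD | rewrite mulrDl addrACA].
- move=> a _ [u [w [Iu ->]]]; exists (a * u), (a * w).
  by split; [exact: idealMl | rewrite mulrDr mulrA].
Qed.

Lemma min_size_ex (R : nzSemiRingType) (P : {poly R} -> Prop) :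
  (exists p, P p) ->
  exists2 p, P p & forall q, P q -> (size p <= size q)%N.
Proof.
case=> p; have [n le_pn] := ubnP (size p).
elim: n p le_pn => // n IHn p le_pn Pp.
case: (classic (exists2 q, P q & (size q < size p)%N)) => [[q Pq lt_qp]|nex].
  by apply: IHn Pq; apply: leq_trans lt_qp _.
exists p => // q Pq; rewrite leqNgt; apply/negP => lt_qp; apply: nex.
by exists q.
Qed.

(** * Lifting points from R to R[X] *)

Section Extension.
Variables (R : idomainType) (Q : {poly R} -> Prop).
Hypothesis prQ : is_prime Q.

Let idQ : is_ideal Q. Proof. by case: prQ. Qed.
(** Contraction of [Q] to [R]; [coefQ0] describes its extension back to [R[X]]. *)
Let Q0 r := Q r%:P.
Let coefQ0 (g : {poly R}) := forall i, Q0 g`_i.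

Lemma coefs_in_prime g : coefQ0 g -> Q g.
Proof.
move=> Qg; rewrite -[g]coefK poly_def; apply: (ideal_sum idQ) => i _.
by rewrite -mul_polyC; apply: (idealMr idQ); apply: Qg.
Qed.

(** Leading terms with coefficient in [Q0] lie in [Q], hence in [J], and can be removed one by one;
    this stops because some coefficient is outside [Q0]. *)
Lemma trim_lead (J : {poly R} -> Prop) g :
  is_ideal J -> (forall x, Q x -> J x) -> J g -> ~ coefQ0 g ->
  exists2 h, J h & (size h <= size g)%N /\ ~ Q0 (lead_coef h).
Proof.
move=> idJ QJ; have [n le_gn] := ubnP (size g).
elim: n g le_gn => // n IHn g le_gn Jg nQg.
case: (classic (Q0 (lead_coef g))) => [Qlg|nQlg]; last by exists g.
have nz_g : g != 0.
  by apply/eqP => g0; apply: nQg => i; rewrite g0 coef0; exact: (ideal0 idQ).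
pose m := lead_coef g *: 'X^((size g).-1).
have Qm : Q m by rewrite /m -mul_polyC; apply: idealMr.
have lt_sz : (size (g - m)%R < size g)%N.
  have le_m : (size m <= size g)%N.
    by rewrite (leq_trans (size_scale_leq _ _))// size_polyXn prednK// size_poly_gt0.
  rewrite ltn_neqAle (leq_trans (size_polyD _ _)) ?andbT; last first.
    by rewrite geq_max leqnn size_polyN.
  apply/eqP => eq_sz; have : lead_coef (g - m) = 0.
    by rewrite lead_coefE eq_sz coefB coefZ coefXn eqxx mulr1 -lead_coefE subrr.
  by move/eqP; rewrite lead_coef_eq0 -size_poly_eq0 eq_sz size_poly_eq0 (negPf nz_g).
have [||| h Jh [le_h nQh]] := IHn (g - m).
- exact: leq_trans lt_sz _.
- by apply: idealB => //; apply: QJ.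
- move=> Qgm; apply: nQg => i.
  have -> : g`_i = (g - m)`_i + m`_i by rewrite coefB subrK.
  rewrite /Q0 polyCD; apply: idealD => //; first exact: Qgm.
  by rewrite coefZ polyCM; apply: idealMr.
by exists h => //; split=> //; apply: leq_trans le_h (ltnW lt_sz).
Qed.

Lemma pseudo_rem (p h : {poly R}) : h != 0 ->
  exists N q r, [/\ lead_coef h ^+ N *: p = q * h + r & (size r < size h)%N].
Proof.
move=> nz_h; exists (scalp p h), (p %/ h), (p %% h).
by rewrite Pdiv.Idomain.divp_eq ltn_modp.
Qed.

(* Pseudo-division by elements of least degree, in [Q] and then in [Q + (f)],
   replaces the usual argument over the fraction field of [R / Q0]. *)
Lemma extend_point (f : {poly R}) : ~ Q f ->
  exists2 r, ~ Q0 r & forall (k : closedFieldType) (phi : {rmorphism R -> k}),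
    (forall s, Q0 s -> phi s = 0) -> phi r != 0 ->
    exists2 t, (forall g, Q g -> (map_poly phi g).[t] = 0)
             & (map_poly phi f).[t] != 0.
Proof.
move=> nQf; have [_ Q1 QM] := prQ.
have map0 (k : closedFieldType) (phi : {rmorphism R -> k}) g :
    (forall s, Q0 s -> phi s = 0) -> coefQ0 g -> map_poly phi g = 0.
  by move=> phi0 Qg; apply/polyP => i; rewrite coef_map coef0 /= phi0 //; exact: Qg.
(* If [Q] is extended from [Q0], its image under [phi] is zero and any [t] is a common root; a
   coefficient of [f] outside [Q0] ensures a nonroot of [f]. *)
case: (classic (forall g, Q g -> coefQ0 g)) => [Qcoef|].
  have /not_all_ex_not[i nQfi] : ~ coefQ0 f by move/coefs_in_prime.
  exists f`_i => // k phi phi0 nz; have /closed_nonrootP[t nz_t] : map_poly phi f != 0.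
    by apply: contraNneq nz => f0; rewrite -coef_map f0 coef0.
  by exists t => // g Qg; rewrite map0 ?horner0 //; apply: Qcoef.
move=> /not_all_ex_not[g0 /(imply_to_and (Q g0))[Qg0 nQg0]].
(* [p] plays the minimal polynomial of the class of [X] over the fraction field of [R / Q0]. *)
have [p [Qp nQlp] min_p] : exists2 p, Q p /\ ~ Q0 (lead_coef p)
    & forall q, Q q /\ ~ Q0 (lead_coef q) -> (size p <= size q)%N.
  apply: min_size_ex; have [h Qh [_ nQh]] := trim_lead idQ (fun _ => id) Qg0 nQg0.
  by exists h.
have small_p q : Q q -> (size q < size p)%N -> coefQ0 q.
  move=> Qq lt_q; apply: NNPP => nQq.
  have [h Qh [le_h nQh]] := trim_lead idQ (fun _ => id) Qq nQq.
  by have := leq_trans (leq_ltn_trans le_h lt_q) (min_p h (conj Qh nQh)); rewrite ltnn.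
have [idJ QJ Jf] := ideal_add1P f idQ; set J := ideal_add1 Q f in idJ QJ Jf.
(* [h] plays the gcd of [p] and [f]. *)
have [h [Jh nQlh] min_h] : exists2 h, J h /\ ~ Q0 (lead_coef h)
    & forall q, J q /\ ~ Q0 (lead_coef q) -> (size h <= size q)%N.
  by apply: min_size_ex; exists p; split=> //; apply: QJ.
have small_h q : J q -> (size q < size h)%N -> Q q.
  move=> Jq lt_q; apply: coefs_in_prime; apply: NNPP => nQq.
  have [h' Jh' [le_h' nQh']] := trim_lead idJ QJ Jq nQq.
  by have := leq_trans (leq_ltn_trans le_h' lt_q) (min_h h' (conj Jh' nQh')); rewrite ltnn.
have nz_lc q : ~ Q0 (lead_coef q) -> q != 0.
  by move=> nQq; apply/eqP => q0; apply: nQq; rewrite q0 lead_coef0; exact: (ideal0 idQ).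
have nQX q N : ~ Q0 (lead_coef q) -> ~ Q0 (lead_coef q ^+ N).
  by move=> nQq; rewrite /Q0 polyC_exp => /(primeX prQ).
(* [h] is constant: otherwise it pseudo-divides [p] modulo [Q], so the quotient or [h] lies in [Q].
   The former contradicts the minimality of [p], the latter puts [f] in [Q]. *)
have [sz_h|sz_h] := leqP (size h) 1; last first.
  exfalso; have [N [q [r [eqp lt_r]]]] := pseudo_rem p (nz_lc _ nQlh).
  have Qr : Q r.
    apply: small_h => //; have -> : r = lead_coef h ^+ N *: p - q * h by rewrite eqp addrAC subrr add0r.
    by apply: idealB => //; [rewrite -mul_polyC|]; apply: idealMl => //; apply: QJ.
  have Qqh : Q (q * h).
    have -> : q * h = lead_coef h ^+ N *: p - r by rewrite eqp addrK.
    by apply: idealB => //; rewrite -mul_polyC; apply: idealMl.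
  case: (QM _ _ Qqh) => [Qq|Qh].
    have nz_hN : lead_coef h ^+ N != 0.
      by rewrite expf_neq0 // lead_coef_eq0 nz_lc.
    have le_hp : (size h <= size p)%N by apply: min_h; split=> //; apply: QJ.
    have eq_sz : size (lead_coef h ^+ N *: p) = size (q * h).
      have lt_rp : (size r < size (lead_coef h ^+ N *: p)%R)%N.
        by rewrite size_scale // (leq_trans lt_r).
      have -> : q * h = lead_coef h ^+ N *: p - r by rewrite eqp addrK.
      by rewrite size_polyDl // size_polyN.
    have eq_lc : lead_coef (q * h) = lead_coef h ^+ N * lead_coef p.
      have lt_rp : (size (- r)%R < size (lead_coef h ^+ N *: p)%R)%N.
        by rewrite size_polyN size_scale // (leq_trans lt_r).
      have -> : q * h = lead_coef h ^+ N *: p - r by rewrite eqp addrK.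
      by rewrite lead_coefDl // lead_coefZ.
    have nQlq : ~ Q0 (lead_coef q).
      move=> Qlq; have : Q0 (lead_coef (q * h)).
        by rewrite lead_coefM /Q0 polyCM; apply: idealMr.
      rewrite eq_lc /Q0 polyCM => /QM[]; last by [].
      exact: nQX.
    have := min_p q (conj Qq nQlq); rewrite -(size_scale p nz_hN) eq_sz.
    rewrite size_mul ?nz_lc // leqNgt => /negP; apply.
    rewrite -subn1 -addnBA ?(ltnW sz_h) // -{1}[size q]addn0 ltn_add2l subn_gt0 //.
  have [N' [q' [r' [eqf lt_r']]]] := pseudo_rem f (nz_lc _ nQlh).
  have Qr' : Q r'.
    apply: small_h => //.
    have -> : r' = lead_coef h ^+ N' *: f - q' * h by rewrite eqf addrAC subrr add0r.
    by apply: idealB => //; [rewrite -mul_polyC|]; apply: idealMl.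
  have : Q (lead_coef h ^+ N' *: f) by rewrite eqf; apply: idealD => //; apply: idealMl.
  by rewrite -mul_polyC => /QM[] //; apply: nQX.
have [r2 def_h] : exists r2, h = r2%:P by exists h`_0; apply: size1_polyC.
rewrite def_h lead_coefC in nQlh.
(* The first factor keeps the image of [p] nonconstant, so that it has a root [t]; the second, of
   the form [u + w * f] with [u] in [Q], keeps [f] from vanishing at [t]. *)
exists (lead_coef p * r2) => [|k phi phi0].
  by rewrite /Q0 polyCM => /QM[].
rewrite rmorphM mulf_eq0 => /norP[nz_lp nz_r2].
have sz_p : size (map_poly phi p) != 1%N.
  rewrite size_map_poly_id0 // eqn_leq negb_and -!ltnNge; apply/orP; left.
  rewrite ltnNge; apply/negP => /size1_polyC def_p.
  by apply: nQlp; rewrite def_p lead_coefC /Q0 -def_p.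
have /closed_rootP[t /rootP pt0] := sz_p.
have Qt g : Q g -> (map_poly phi g).[t] = 0.
  move=> Qg; have [N [q [r [eqg lt_r]]]] := pseudo_rem g (nz_lc _ nQlp).
  have Qr : Q r.
    have -> : r = lead_coef p ^+ N *: g - q * p by rewrite eqg addrAC subrr add0r.
    by apply: idealB => //; [rewrite -mul_polyC|]; apply: idealMl.
  have /(congr1 (fun u => (map_poly phi u).[t])) := eqg.
  rewrite rmorphD rmorphM /= map_polyZ /= !hornerE pt0 (map0 _ _ r) //; last exact: small_p.
  rewrite horner0 mulr0 addr0 rmorphXn => /eqP.
  by rewrite mulf_eq0 expf_eq0 (negPf nz_lp) andbF => /eqP.
exists t => //; have [u [w [Qu eqh]]] := Jh.
apply: contraNneq nz_r2 => ft0.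
have /(congr1 (fun u => (map_poly phi u).[t])) := eqh.
by rewrite def_h rmorphD rmorphM /= map_polyC !hornerE Qt // ft0 mulr0 addr0 => ->.
Qed.

End Extension.

(** Induction on [n]: a zero of the contracted prime at which the [r] of [extend_point] does not
    vanish extends by one coordinate. In zero variables, a prime contains no nonzero constant. *)
Lemma prime_nullstellensatz (k : closedFieldType) n (P : {mpoly k[n]} -> Prop) f :
  is_prime P -> ~ P f ->
  exists2 v, (forall g, P g -> g.@[v] = 0) & f.@[v] != 0.
Proof.
elim: n P f => [|n IHn] P f prP nPf.
  have P_C c : P c%:MP -> c = 0.
    move=> Pc; apply/eqP/negPn/negP => nz_c; case: prP => idP P1 _; apply: P1.
    by rewrite -mpolyC1 -(mulVf nz_c) mpolyCM; apply: idealMl.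
  exists (fun _ => 0) => [g Pg|].
    by rewrite (nvar0_mpolyC g) mevalC; apply: P_C; rewrite -nvar0_mpolyC.
  apply/eqP => f0; apply: nPf; rewrite (nvar0_mpolyC f); move: f0.
  rewrite {1}(nvar0_mpolyC f) mevalC => ->; rewrite mpolyC0.
  by apply: ideal0; case: prP.
pose Q (g : {poly {mpoly k[n]}}) := P (mjoin g).
have prQ : is_prime Q := prime_comap (@mjoin n k) prP.
have nQf : ~ Q (muni f) by rewrite /Q muniK.
have [r nQr ext] := extend_point prQ nQf.
pose P0 (s : {mpoly k[n]}) := Q s%:P.
have prP0 : is_prime P0 := prime_comap (@polyC {mpoly k[n]}) prQ.
have [v v0 nz_v] := IHn P0 r prP0 nQr.
have [t Qt nz_t] := ext k (meval v) v0 nz_v.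
exists (point_rcons v t) => [g Pg|]; rewrite meval_point_rcons //.
by apply: Qt; rewrite /Q muniK.
Qed.

(** By Zorn's lemma: an ideal maximal among those containing [I] and disjoint from the
    multiplicative set [S] is prime. *)
Lemma prime_avoiding (A : comNzRingType) (I S : A -> Prop) :
  is_ideal I -> S 1 -> (forall x y, S x -> S y -> S (x * y)) ->
  (forall x, I x -> ~ S x) ->
  exists2 P, is_prime P & (forall x, I x -> P x) /\ (forall x, P x -> ~ S x).
Proof.
move=> idI S1 SM IS.
(* The junk case [J = {}] is allowed so that the empty chain has an upper bound. *)
pose good (J : A -> Prop) := (forall x, ~ J x) \/
  [/\ is_ideal J, forall x, I x -> J x & forall x, J x -> ~ S x].
have [F Fgood Ftot|P [goodP maxP]] := @classical_sets.Zorn_bigcup A good.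
  case: (classic (exists2 J, F J & exists x, J x)) => [[J0 FJ0 [x0 J0x0]]|nex].
    have goodJ J x : F J -> J x ->
        [/\ is_ideal J, forall x, I x -> J x & forall x, J x -> ~ S x].
      by move=> FJ Jx; have [/(_ x)|//] := Fgood J FJ.
    right; split.
    - split.
      + by exists J0 => //; have [idJ _ _] := goodJ _ _ FJ0 J0x0; apply: ideal0.
      + move=> x y [J FJ Jx] [J' FJ' Jy].
        have [JJ'|JJ'] := Ftot J J' FJ FJ'.
          exists J' => //; have [idJ _ _] := goodJ _ _ FJ' Jy.
          by apply: idealD => //; apply: JJ'.
        exists J => //; have [idJ _ _] := goodJ _ _ FJ Jx.
        by apply: idealD => //; apply: JJ'.
      + move=> a x [J FJ Jx]; exists J => //; have [idJ _ _] := goodJ _ _ FJ Jx.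
        exact: idealMl.
    - by move=> x Ix; exists J0 => //; have [_ IJ _] := goodJ _ _ FJ0 J0x0; apply: IJ.
    - by move=> x [J FJ Jx]; have [_ _] := goodJ _ _ FJ Jx; apply.
  by left=> x [J FJ Jx]; apply: nex; exists J => //; exists x.
(* A maximal [P] that is empty would be strictly contained in [I]. *)
have [idP IP PS] : [/\ is_ideal P, forall x, I x -> P x & forall x, P x -> ~ S x].
  case: goodP => // P0; exfalso; apply: (maxP I); last by right; split.
  split=> [x /P0 //|sIP]; apply: (P0 0); apply: sIP; exact: ideal0.
have meetS x : ~ P x -> exists u w, P u /\ S (u + w * x).
  move=> nPx; apply: NNPP => nex; have [idPx sP Px] := ideal_add1P x idP.
  apply: (maxP (ideal_add1 P x)).
    by split=> // /(_ x Px).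
  right; split=> // [y Iy|y [u [w [Pu ->]]] Sy].
    by apply/sP/IP.
  by apply: nex; exists u, w.
exists P => //; split=> // [P1|x y Pxy]; first exact: (PS 1).
case: (classic (P x)) => [|/meetS[u [w [Pu Su]]]]; first by left.
case: (classic (P y)) => [|/meetS[u' [w' [Pu' Su']]]]; first by right.
exfalso; apply: (PS _ _ (SM _ _ Su Su')).
rewrite mulrDr; apply: idealD => //; first exact: idealMl.
rewrite mulrDl; apply: idealD => //; first exact: idealMr.
by rewrite mulrACA; apply: idealMl.
Qed.

(** * Transcendence degree and chains of primes *)

Lemma msize_exp_le n (k : fieldType) (f : {mpoly k[n]}) d e :
  (msize f <= d.+1)%N -> (msize (f ^+ e) <= (e * d).+1)%N.
Proof.
move=> le_f; elim: e => [|e IHe]; first by rewrite expr0 msize1.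
have [->|nz_f] := eqVneq f 0; first by rewrite expr0n /= msize0.
rewrite exprS msizeM ?expf_neq0 // -ltnS prednK; last first.
  by rewrite addn_gt0 lt0n msize_poly_eq0 nz_f.
by rewrite mulSn (leq_trans (leq_add le_f IHe)) // addSn addnS.
Qed.

Lemma msize_prod_le n (k : fieldType) (I : finType) (F : I -> {mpoly k[n]}) d :
  (forall i, msize (F i) <= d.+1)%N -> (msize (\prod_i F i)%R <= (#|I| * d).+1)%N.
Proof.
move=> le_F; rewrite cardE -sum1_size big_enum /=.
elim/big_rec2: _ => [|i y1 y2 _ IH]; first by rewrite msize1.
have [->|nz_f] := eqVneq (F i) 0; first by rewrite mul0r msize0.
have [->|nz_y] := eqVneq y2 0; first by rewrite mulr0 msize0.
rewrite msizeM // -ltnS prednK; last by rewrite addn_gt0 lt0n msize_poly_eq0 nz_f.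
by rewrite mulnDl mul1n (leq_trans (leq_add (le_F i) IH)) // addSn addnS.
Qed.

Lemma card_bmultinom_le n E : (#|{: 'X_{1..n < E}}| <= E ^ n)%N.
Proof.
have lt_m (m : 'X_{1..n < E}) i : (m i < E)%N.
  have := bmdeg m; apply: leq_ltn_trans.
  by rewrite mdegE (bigD1 i) //= leq_addr.
pose h (m : 'X_{1..n < E}) : {ffun 'I_n -> 'I_E} := [ffun i => Ordinal (lt_m m i)].
have inj_h : injective h.
  move=> m1 m2 eq_h; apply/val_inj/mnmP => i.
  by have /ffunP/(_ i) := eq_h; rewrite !ffunE => /(congr1 val).
by have := leq_card h inj_h; rewrite card_ffun !card_ord.
Qed.

(* There are [D ^ N] monomials with exponents less than [D] in [f], all in a
   space of dimension [O(D ^ n)]. *)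
Lemma algebraically_dependent (k : fieldType) n N (f : 'I_N -> {mpoly k[n]}) :
  (n < N)%N ->
  exists2 p : {mpoly k[N]}, p != 0 & mmap (@mpolyC n k) f p = 0.
Proof.
move=> lt_nN; pose d := (\max_i msize (f i))%N.
(* The degrees of the products [F e] stay below [E], and [D] exceeds [(N * d).+1 ^ n], so that [E ^
   n <= ((N * d).+1 * D) ^ n < D ^ n.+1 <= D ^ N]. *)
pose D := ((N * d).+1 ^ n).+1; pose E := (N * (D * d)).+1.
pose row := {ffun 'I_N -> 'I_D}; pose col := 'X_{1..n < E}.
pose F (e : row) := \prod_i f i ^+ e i.
have szF e : (msize (F e) <= E)%N.
  rewrite /F /E -[X in (X * _)%N]card_ord; apply: msize_prod_le => i.
  apply: leq_trans (msize_exp_le (d := d) _ _) _.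
    by rewrite (leq_trans _ (leqnSn _)) // /d (leq_bigmax i).
  by rewrite ltnS leq_mul2r ltnW ?orbT.
have lt_card : (#|{: col}| < #|{: row}|)%N.
  apply: leq_ltn_trans (card_bmultinom_le _ _) _; rewrite card_ffun !card_ord.
  apply: (@leq_trans (D ^ n.+1)); last by rewrite leq_pexp2l.
  have leE : (E <= (N * d).+1 * D)%N.
    by rewrite /E mulSn [(D * d)%N]mulnC mulnA -add1n leq_add2r.
  apply: (@leq_ltn_trans (((N * d).+1 * D) ^ n)).
    by case: (posnP n) => [->|n_gt0] //; rewrite leq_exp2r.
  by rewrite expnMn expnS ltn_mul2r expn_gt0 /= ltnS leqnn.
pose T : 'M[k]_(#|{: row}|, #|{: col}|) :=
  \matrix_(i, j) (F (enum_val i))@_(enum_val j : 'X_{1..n < E}).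
(* There are more products than monomials, so a nonzero left kernel vector gives the coefficients of
   a relation. *)
have /rowV0Pn[u /sub_kermxP uT0 nz_u] : kermx T != 0.
  rewrite kermx_eq0 /row_free neq_ltn (leq_ltn_trans (rank_leq_col T)) //.
pose expo (e : row) : 'X_{1..N} := [multinom (e i : nat) | i < N].
have inj_expo : injective expo.
  by move=> e1 e2 /mnmP eq_e; apply/ffunP => i; apply/val_inj; have := eq_e i; rewrite !mnmE.
exists (\sum_i u 0 i *: 'X_[expo (enum_val i)]).
  have [i nz_ui] := rV0Pn _ nz_u; apply: contraNneq nz_ui => /mpolyP/(_ (expo (enum_val i))).
  rewrite mcoeff0 raddf_sum (bigD1 i) //= mcoeffZ mcoeffX eqxx mulr1 big1 ?addr0 => [->//|j ne_ji].
  by rewrite mcoeffZ mcoeffX (inj_eq inj_expo) (inj_eq enum_val_inj) (negPf ne_ji) mulr0.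
rewrite raddf_sum /=; apply/mpolyP => m; rewrite mcoeff0.
under eq_bigr => i _ do rewrite mmapZ mmapX mul_mpolyC.
have -> : \sum_i u 0 i *: mmap1 f (expo (enum_val i)) = \sum_i u 0 i *: F (enum_val i).
  by apply: eq_bigr => i _; congr (_ *: _); apply: eq_bigr => j _; rewrite mnmE.
have [lt_mE|le_Em] := ltnP (mdeg m) E.
  pose j := enum_rank (BMultinom lt_mE : col).
  have /matrixP/(_ 0 j) := uT0; rewrite !mxE => <-.
  rewrite raddf_sum; apply: eq_bigr => i _ /=; rewrite mcoeffZ mxE enum_rankK //.
rewrite raddf_sum big1 // => i _ /=; rewrite mcoeffZ memN_msupp_eq0 ?mulr0 //.
by apply: msize_mdeg_ge; apply: leq_trans le_Em.
Qed.

(** As [f] is not in the prime [Q], powers of [X] dividing [p] can be cancelled. The lowest nonzero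
    coefficient then differs from an element of [Q] by a multiple of [f], so it lies in [Q']. *)
Lemma lowest_coef_in (R A : comNzRingType) (phi : {rmorphism R -> A})
    (Q Q' : A -> Prop) (f : A) (p : {poly R}) :
  is_prime Q -> is_ideal Q' -> (forall x, Q x -> Q' x) -> ~ Q f -> Q' f ->
  p != 0 -> Q (map_poly phi p).[f] ->
  exists2 r, r != 0 & Q' (phi r).
Proof.
move=> [idQ _ QM] idQ' QQ' nQf Q'f.
elim/poly_ind: p => [|p c IHp]; first by rewrite eqxx.
rewrite rmorphD rmorphM /= map_polyX map_polyC hornerMXaddC /= => nz_pc Qpc.
have [c0|nz_c] := eqVneq c 0.
  move: Qpc nz_pc; rewrite c0 polyC0 rmorph0 !addr0 => /QM[Qp|/nQf[]].
  by have [->|nz_p _] := eqVneq p 0; [rewrite mul0r eqxx | apply: IHp].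
exists c => //.
have -> : phi c = (map_poly phi p).[f] * f + phi c - (map_poly phi p).[f] * f.
  by rewrite addrAC subrr add0r.
by apply: idealB => //; [apply: QQ' | apply: idealMl].
Qed.

(** One step up a chain of primes removes one variable, the last one, specialized at [f]. *)
Lemma lowest_mpoly_in (k : fieldType) (A : comNzRingType) (phi : {rmorphism k -> A})
    (Q Q' : A -> Prop) m (h : 'I_m -> A) (f : A) (p : {mpoly k[m.+1]}) :
  is_prime Q -> is_ideal Q' -> (forall x, Q x -> Q' x) -> ~ Q f -> Q' f ->
  p != 0 -> Q (mmap phi (point_rcons h f) p) ->
  exists2 r : {mpoly k[m]}, r != 0 & Q' (mmap phi h r).
Proof.
move=> prQ idQ' QQ' nQf Q'f; rewrite -muni_eq0 mmap_muni point_rcons_max => nz_p Qp.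
apply: (lowest_coef_in (phi := mmap phi h)) prQ idQ' QQ' nQf Q'f nz_p _.
suff -> : map_poly (mmap phi h) (muni p) =
  map_poly (mmap phi (fun i => point_rcons h f (widen i))) (muni p) by [].
apply: eq_map_poly => q; apply: eq_bigr => e _; congr (_ * _).
by apply: mmap1_eq => i; rewrite point_rcons_widen.
Qed.

(* A strict chain of primes of length 3 uses up three transcendence degrees, so
   its top cannot avoid the algebra generated by [m >= n - 2] elements. *)
Lemma prime_chain3 (k : fieldType) n m (l : 'I_m -> {mpoly k[n]})
    (Q : nat -> {mpoly k[n]} -> Prop) :
  (n < m.+3)%N -> (forall i, (i < 4)%N -> is_prime (Q i)) ->
  (forall i, (i < 3)%N -> (forall x, Q i x -> Q i.+1 x) /\ exists2 f, ~ Q i f & Q i.+1 f) ->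
  exists2 s : {mpoly k[m]}, s != 0 & Q 3 (mmap (@mpolyC n k) l s).
Proof.
move=> lt_nm prQ chQ; have idQ i : (i < 4)%N -> is_ideal (Q i) by move=> /prQ[].
have [Q01 [f0 nf0 f0Q]] := chQ 0 isT.
have [Q12 [f1 nf1 f1Q]] := chQ 1 isT.
have [Q23 [f2 nf2 f2Q]] := chQ 2 isT.
(* The chain is climbed from [Q 0] and each step removes the last variable, hence [f0] comes
   last. *)
pose h2 := point_rcons l f2; pose h1 := point_rcons h2 f1.
have [p nz_p p0] := algebraically_dependent (point_rcons h1 f0) lt_nm.
have Qp : Q 0 (mmap (@mpolyC n k) (point_rcons h1 f0) p).
  by rewrite p0; apply: ideal0; apply: idQ.
have [p1 nz1 Qp1] := lowest_mpoly_in (prQ 0 isT) (idQ 1 isT) Q01 nf0 f0Q nz_p Qp.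
have [p2 nz2 Qp2] := lowest_mpoly_in (prQ 1 isT) (idQ 2 isT) Q12 nf1 f1Q nz1 Qp1.
have [p3 nz3 Qp3] := lowest_mpoly_in (prQ 2 isT) (idQ 3 isT) Q23 nf2 f2Q nz2 Qp2.
by exists p3.
Qed.

(** * Elimination in codimension 3 *)

Definition vanishing (k : fieldType) (V : vectType k) (X : V -> Prop) (f : polyfun V) :=
  forall v, X v -> peval f v = 0.

Definition zero_set (k : fieldType) (V : vectType k) (I : polyfun V -> Prop) (v : V) :=
  forall f, I f -> peval f v = 0.

Definition point_of (k : fieldType) (V : vectType k) (x : 'I_(\dim {:V}) -> k) : V :=
  \sum_i x i *: (vbasis {:V})`_i.

Lemma coords_point_of (k : fieldType) (V : vectType k) (x : 'I_(\dim {:V}) -> k) :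
  coords (point_of x) =1 x.
Proof. by move=> i; rewrite /coords coord_sum_free // (basis_free (vbasisP _)). Qed.

Lemma peval_point_of (k : fieldType) (V : vectType k) (f : polyfun V) x :
  peval f (point_of x) = f.@[x].
Proof. by apply: meval_eq => i; rewrite coords_point_of. Qed.

Lemma zclosed_zero_set (k : fieldType) (V : vectType k) (I : polyfun V -> Prop) :
  zclosed (zero_set I).
Proof. by exists I. Qed.

Lemma vanishing_ideal (k : fieldType) (V : vectType k) (X : V -> Prop) :
  is_ideal (vanishing X).
Proof.
split.
- by move=> v _; rewrite /peval rmorph0.
- by move=> f g f0 g0 v Xv; rewrite /peval rmorphD /= [_.@[_]]f0 // [_.@[_]]g0 // addr0.
- by move=> a f f0 v Xv; rewrite /peval rmorphM /= [X in _ * X]f0 // mulr0.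
Qed.

Lemma vanishing_prime (k : fieldType) (V : vectType k) (X : V -> Prop) :
  irreducible X -> is_prime (vanishing X).
Proof.
case=> -[v0 Xv0] irrX; split; first exact: vanishing_ideal.
  by move=> /(_ v0 Xv0)/eqP; rewrite /peval rmorph1 oner_eq0.
move=> f g fg0.
have [|X0|X0] := irrX (zero_set (eq f)) (zero_set (eq g)) (zclosed_zero_set _) (zclosed_zero_set _).
- move=> v Xv; have /eqP := fg0 v Xv; rewrite /peval rmorphM mulf_eq0.
  by move=> /orP[]/eqP h; [left|right] => _ <-.
- by left=> v /X0; apply.
- by right=> v /X0; apply.
Qed.

(** If neither closed set contains the zero set, each has an equation outside [P]; their product is
    outside [P], and the Nullstellensatz gives a zero of [P] lying on neither. *)
Lemma zero_set_irreducible (k : closedFieldType) (V : vectType k) (P : polyfun V -> Prop) :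
  is_prime P -> irreducible (zero_set P).
Proof.
move=> prP; have [idP P1 PM] := prP; split.
  have [x Px _] := prime_nullstellensatz prP P1.
  by exists (point_of x) => f Pf; rewrite peval_point_of Px.
move=> A B [I AE] [J BE] cover; apply: NNPP => /not_or_and[nA nB].
have out X K : (forall v, X v <-> (forall f : polyfun V, K f -> peval f v = 0)) ->
    ~ Defs.subset (zero_set P) X -> exists2 f, K f & ~ P f.
  move=> XE nX; apply: NNPP => nex; apply: nX => v Pv; apply/XE => f Kf; apply: Pv.
  by apply: NNPP => nPf; apply: nex; exists f.
have [f If nPf] := out _ _ AE nA; have [g Jg nPg] := out _ _ BE nB.
have nPfg : ~ P (f * g) by move=> /PM[].
have [x Px] := prime_nullstellensatz prP nPfg.
rewrite mevalM mulf_eq0 => /norP[nz_f nz_g].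
case: (cover (point_of x)) => [h Ph|/AE/(_ f If)|/BE/(_ g Jg)].
- by rewrite peval_point_of Px.
- by rewrite peval_point_of => /eqP; rewrite (negPf nz_f).
- by rewrite peval_point_of => /eqP; rewrite (negPf nz_g).
Qed.

(** Otherwise a prime [P] above [I] avoids the values at [l] of all nonzero polynomials. Its zero
    set lies in [Z], so a chain of length 3 starts there, against [prime_chain3]. *)
Lemma codim3_elimination (k : closedFieldType) (V : vectType k) (Z : V -> Prop)
    (I : polyfun V -> Prop) m (l : 'I_m -> polyfun V) :
  codim_ge (fun _ : V => True) Z 3 -> is_ideal I ->
  Defs.subset (zero_set I) Z -> (\dim {:V} < m.+3)%N ->
  exists2 s : {mpoly k[m]}, s != 0 & I (mmap (@mpolyC _ k) l s).
Proof.
move=> codimZ idI subZ lt_m; apply: NNPP => nex.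
pose S (x : polyfun V) := exists2 s : {mpoly k[m]}, s != 0 & x = mmap (@mpolyC _ k) l s.
have [||f If [s nz_s def_f]|P prP [IP PS]] := @prime_avoiding _ I S idI.
- by exists 1; rewrite ?rmorph1 ?oner_neq0.
- move=> _ _ [s nz_s ->] [t nz_t ->]; exists (s * t); first exact: mulf_neq0.
  by rewrite rmorphM.
- by apply: nex; exists s; rewrite -?def_f.
pose Y := zero_set P.
have clY : rel_closed (fun _ : V => True) Y.
  by exists Y; [exact: zclosed_zero_set | move=> v; split=> [|[]]].
have [||C [irrC strC] C0] := codimZ Y clY; first exact: zero_set_irreducible.
  by move=> v Yv; apply: subZ => f /IP; apply: Yv.
(* Vanishing ideals reverse inclusions, so the indices are reversed: [Q 3] belongs to [Y]. *)
pose Q i := vanishing (C (3 - i)%N).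
have [i _|i lt_i|s nz_s Qs] := @prime_chain3 k _ m l Q lt_m.
- by apply: vanishing_prime; have [] := irrC (3 - i)%N (leq_subr _ _).
- have lt_i' : (3 - i.+1 < 3)%N by rewrite ltn_subrL.
  have [sC nsC] := strC (3 - i.+1)%N lt_i'.
  have eq_i : (3 - i.+1).+1 = (3 - i)%N by rewrite subnS prednK // subn_gt0.
  rewrite eq_i in sC nsC; split; first by move=> f Qf v /sC; apply: Qf.
  have [[D [J DE] CE] _] := irrC (3 - i.+1)%N (ltnW lt_i').
  apply: NNPP => nf; apply: nsC => v Cv; apply/CE; split=> //; apply/DE => f Jf.
  apply: NNPP => nfv; apply: nf; exists f; first by move=> /(_ v Cv).
  by move=> w /CE[_ /DE/(_ f Jf)].
(* By the Nullstellensatz, what vanishes on [Y] lies in [P]. *)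
- apply: (PS (mmap (@mpolyC _ k) l s)); last by exists s.
  apply: NNPP => nP; have [x Px /eqP[]] := prime_nullstellensatz prP nP.
  rewrite -peval_point_of; apply: Qs; apply/C0 => f Pf.
  by rewrite peval_point_of Px.
Qed.

(** * Regular sequences *)

Section TopCoefficient.
Variable T : comNzRingType.
Implicit Types p q : {poly T}.

(** The value [v] may be zero, which makes the predicate stable under sums and products. *)
Definition top_coef p n (v : T) := (size p <= n.+1)%N /\ p`_n = v.

Lemma top_coefM p q n m v w :
  top_coef p n v -> top_coef q m w -> top_coef (p * q) (n + m) (v * w).
Proof.
move=> [szp <-] [szq <-]; split.
  apply: leq_trans (size_polyMleq _ _) _.
  by rewrite -subn1 leq_subLR (leq_trans (leq_add szp szq)) // addSn addnS add1n.
have lt_n : (n < (n + m).+1)%N by rewrite ltnS leq_addr.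
rewrite coefM (bigD1 (Ordinal lt_n)) //= addKn big1 ?addr0 // => i ne_in.
have [lt_in|le_ni] := ltnP i n.
  rewrite (nth_default _ (_ : size q <= n + m - i)%N) ?mulr0 //.
  by rewrite (leq_trans szq) // ltn_subRL ltn_add2r.
rewrite nth_default ?mul0r // (leq_trans szp) // ltn_neqAle le_ni andbT eq_sym.
by apply: contraNneq ne_in => eq_in; apply/eqP/val_inj.
Qed.

Lemma top_coefX p n v e : top_coef p n v -> top_coef (p ^+ e) (e * n) (v ^+ e).
Proof.
move=> tp; elim: e => [|e IHe]; first by rewrite !expr0; split; rewrite ?size_poly1 ?coef1.
by rewrite !exprS mulSn; apply: top_coefM.
Qed.

Lemma top_coef_prod (I : Type) (r : seq I) (F : I -> {poly T}) d v :
  (forall i, top_coef (F i) (d i) (v i)) ->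
  top_coef (\prod_(i <- r) F i) (\sum_(i <- r) d i) (\prod_(i <- r) v i).
Proof.
move=> tF; elim/big_ind3: _ => // [|p1 n1 v1 p2 n2 v2]; last exact: top_coefM.
by split; rewrite ?size_poly1 ?coef1.
Qed.

Lemma top_coef_lt p n v m : top_coef p n v -> (n < m)%N -> top_coef p m 0.
Proof.
by move=> [szp _] lt_nm; split; [rewrite (leq_trans szp) // ltnS ltnW | rewrite nth_default // (leq_trans szp)].
Qed.

Lemma top_coef_sum (I : eqType) (r : seq I) (F : I -> {poly T}) n v :
  (forall i, i \in r -> top_coef (F i) n (v i)) ->
  top_coef (\sum_(i <- r) F i) n (\sum_(i <- r) v i).
Proof.
move=> tF; split.
  rewrite big_seq; elim/big_ind: _ => [|p q szp szq|i /tF[]//]; first by rewrite size_poly0.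
  by rewrite (leq_trans (size_polyD _ _)) // geq_max szp.
by rewrite coef_sum big_seq [RHS]big_seq; apply: eq_bigr => i /tF[].
Qed.

End TopCoefficient.

(* [e] is the value at [c] of the top-degree part of [s]. *)
Lemma generic_direction (k : closedFieldType) m (s : {mpoly k[m]}) :
  s != 0 ->
  exists (c : 'I_m -> k) (e : k), e != 0 /\
    forall (T : comNzRingType) (phi : {rmorphism k -> T}) (u : 'I_m -> T),
    lead_coef (mmap (polyC \o phi) (fun i => (u i)%:P + (phi (c i))%:P * 'X) s) = phi e.
Proof.
move=> nz_s; pose d := (msize s).-1.
(* [t] is the homogeneous part of degree [d] of [s]; it contains the leading monomial, so it is
   nonzero. *)
pose t := \sum_(e <- msupp s) (if mdeg e == d then s@_e else 0) *: 'X_[e] : {mpoly k[m]}.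
have nz_t : t != 0.
  have lead_s := mlead_supp nz_s; have mdeg_s : mdeg (mlead s) = d.
    by rewrite /d -(mlead_deg nz_s).
  rewrite mcoeff_msupp in lead_s; apply: contraNneq lead_s => t0.
  have := congr1 (fun p : {mpoly k[m]} => p@_(mlead s)) t0.
  rewrite mcoeff0 raddf_sum /= (bigD1_seq (mlead s)) ?msupp_uniq ?mlead_supp //=.
  rewrite mdeg_s eqxx mcoeffZ mcoeffX eqxx mulr1 big1 ?addr0 => [->//|e ne_e].
  by rewrite mcoeffZ mcoeffX (negPf ne_e) mulr0.
have [c nz_tc] := mpoly_neq0P nz_t.
exists c, t.@[c]; split=> // T phi u.
set p := mmap _ _ _.
(* Each variable is replaced by a polynomial of degree at most 1, so only monomials of degree [d]
   contribute to the coefficient of ['X^d]. *)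
have tX i : top_coef ((u i)%:P + (phi (c i))%:P * 'X) 1 (phi (c i)).
  split; last by rewrite coefD coefC coefMX coefC add0r.
  by rewrite addrC -[_ + _]/(_ * 'X + _) size_MXaddC; case: ifP => // _; rewrite ltnS size_polyC leq_b1.
have [szp top_p] : top_coef p d (phi t.@[c]).
  rewrite /p /mmap /t (raddf_sum (meval c)) rmorph_sum; apply: top_coef_sum => e se.
  rewrite /= mevalZ mevalX.
  have te : top_coef (mmap1 (fun i => (u i)%:P + (phi (c i))%:P * 'X) e) (mdeg e)
                     (phi (\prod_i c i ^+ e i)).
    rewrite mdegE rmorph_prod; apply: top_coef_prod => i.
    by rewrite rmorphXn -[X in top_coef _ X]muln1; apply: top_coefX.
  have tC : top_coef (phi s@_e)%:P 0 (phi s@_e) by split; rewrite ?size_polyC ?leq_b1 ?coefC.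
  case: eqP => [<-|/eqP ne_d]; first by rewrite rmorphM; apply: (top_coefM tC te).
  rewrite mul0r rmorph0; apply: top_coef_lt (top_coefM tC te) _.
  rewrite add0n ltn_neqAle ne_d /= -ltnS /d prednK ?msize_mdeg_lt //.
  by rewrite lt0n msize_poly_eq0.
have nz_e : phi t.@[c] != 0 by rewrite fmorph_eq0.
suff szE : size p = d.+1 by rewrite lead_coefE szE.
by apply/eqP; rewrite eqn_leq szp ltnNge; apply: contra nz_e => le_pd; rewrite -top_p nth_default.
Qed.

(** Regularity on elements: [a] is a nonzerodivisor modulo [b], and [d] modulo [(a, b)]. The three
    may generate the unit ideal. *)
Definition regular3 (A : comNzRingType) (a b d : A) : Prop :=
  [/\ a != 0, b != 0,
      forall u w, a * u = b * w -> exists t, u = b * t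
    & forall g h h', d * g = a * h + b * h' -> exists e e', g = a * e + b * e'].

Lemma regular3_can (A B : comNzRingType) (f : {rmorphism A -> B})
    (f' : {rmorphism B -> A}) (a b d : A) :
  cancel f f' -> cancel f' f -> regular3 (f a) (f b) (f d) -> regular3 a b d.
Proof.
move=> fK f'K [nz_a nz_b reg2 reg3]; split.
- by apply: contraNneq nz_a => ->; rewrite rmorph0.
- by apply: contraNneq nz_b => ->; rewrite rmorph0.
- move=> u w /(congr1 f); rewrite !rmorphM => /reg2[t /(congr1 f')].
  by rewrite rmorphM !fK => ->; exists (f' t).
- move=> g h h' /(congr1 f); rewrite rmorphD !rmorphM => /reg3[e [e' /(congr1 f')]].
  by rewrite rmorphD !rmorphM !fK => ->; exists (f' e), (f' e').
Qed.

(** Divide [w] by [a]: [b] times the remainder is a multiple of [a] of smaller size, hence zero. *)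
Lemma regular_poly2 (R : idomainType) (a u w : {poly R}) (b : R) :
  lead_coef a \is a GRing.unit -> a * u = b%:P * w -> exists t, u = b%:P * t.
Proof.
move=> ua eq_au; have w_eq := Pdiv.IdomainUnit.divp_eq ua w.
have nz_a : a != 0 by apply: contraTneq ua => ->; rewrite lead_coef0 unitr0.
exists (w %/ a); apply/eqP; rewrite -subr_eq0; apply/negPn/negP => nz.
have eq_r : a * (u - b%:P * (w %/ a)) = b%:P * (w %% a).
  by rewrite mulrBr eq_au {1}w_eq mulrDr [a * _]mulrCA [_ * a]mulrC addrAC subrr add0r.
have : (size (b%:P * (w %% a))%R < size a)%N.
  rewrite mul_polyC (leq_ltn_trans (size_scale_leq _ _)) // ltn_modp //.
rewrite -eq_r size_mul // ltnNge => /negP; apply.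
by rewrite -subn1 -addnBA ?leq_addr // size_poly_gt0.
Qed.

(** Reducing [g] and [h'] modulo [a] turns the relation into [d * g1 = b * h1], by size. Since [b]
    and [d] are free of the outer variable, [regular_poly2] applies to each coefficient. *)
Lemma regular_poly3 (R : idomainType) (a : {poly {poly R}}) (b : {poly R}) (d : R) :
  lead_coef a \is a GRing.unit -> lead_coef b \is a GRing.unit -> d != 0 ->
  regular3 a b%:P d%:P%:P.
Proof.
move=> ua ub nz_d.
have nz_a : a != 0 by apply: contraTneq ua => ->; rewrite lead_coef0 unitr0.
have nz_b : b != 0 by apply: contraTneq ub => ->; rewrite lead_coef0 unitr0.
split=> //; [by rewrite polyC_eq0 | by move=> u w; apply: regular_poly2 |].
move=> g h h' eq_g.
have g_eq := Pdiv.IdomainUnit.divp_eq ua g; have h_eq := Pdiv.IdomainUnit.divp_eq ua h'.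
set g1 := g %% a in g_eq; set h1 := h' %% a in h_eq.
have eq_r : d%:P%:P * g1 - b%:P * h1 = a * (h + b%:P * (h' %/ a) - d%:P%:P * (g %/ a)).
  have -> : g1 = g - g %/ a * a by apply/esym/eqP; rewrite subr_eq [_ + _]addrC; apply/eqP.
  have -> : h1 = h' - h' %/ a * a by apply/esym/eqP; rewrite subr_eq [_ + _]addrC; apply/eqP.
  by rewrite !mulrBr eq_g !mulrDr; ring.
have r0 : d%:P%:P * g1 = b%:P * h1.
  apply/eqP; rewrite -subr_eq0; apply/negPn/negP => nz.
  have : (size (d%:P%:P * g1 - b%:P * h1)%R < size a)%N.
    rewrite (leq_ltn_trans (size_polyD _ _)) // size_polyN gtn_max.
    by rewrite !mul_polyC !(leq_ltn_trans (size_scale_leq _ _)) // ltn_modp.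
  have nz' := nz; rewrite eq_r mulf_eq0 (negPf nz_a) /= in nz'.
  rewrite eq_r size_mul // ltnNge => /negP; apply.
  by rewrite -subn1 -addnBA ?leq_addr // size_poly_gt0.
have [t tE] : exists t, g1 = b%:P * t.
  have coef_dvd i : exists t, g1`_i = b * t.
    have := congr1 (fun q : {poly {poly R}} => q`_i) r0.
    rewrite !coefCM => /esym/(regular_poly2 ub)[t ht].
    have /mulfI : d%:P != 0 :> {poly R} by rewrite polyC_eq0.
    move=> inj_d; exists t; apply: inj_d.
    have := congr1 (fun q : {poly {poly R}} => q`_i) r0.
    by rewrite !coefCM ht => ->; rewrite mulrCA.
  have ex_c i : {t | g1`_i = b * t} by apply: constructive_indefinite_description.
  exists (\poly_(i < size g1) sval (ex_c i)).
  apply/polyP => i; rewrite coefCM coef_poly; case: ltnP => [_|le_i].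
    exact: (svalP (ex_c i)).
  by rewrite nth_default // mulr0.
by exists (g %/ a), t; rewrite -tE [a * _]mulrC.
Qed.

Lemma poly_rmorph_ext (R S : comNzRingType) (phi psi : {rmorphism {poly R} -> S}) :
  (forall c, phi c%:P = psi c%:P) -> phi 'X = psi 'X -> phi =1 psi.
Proof.
move=> eqC eqX; elim/poly_ind => [|p c IHp]; first by rewrite !rmorph0.
by rewrite !rmorphD !rmorphM /= IHp eqC eqX.
Qed.

Lemma rmorph_mmap n (k : comNzRingType) (A B : comNzRingType) (f : {rmorphism A -> B})
    (phi : {rmorphism k -> A}) (h : 'I_n -> A) p :
  f (mmap phi h p) = mmap (f \o phi) (fun i => f (h i)) p.
Proof.
rewrite /mmap rmorph_sum; apply: eq_bigr => m _; rewrite rmorphM rmorph_prod.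
by congr (_ * _); apply: eq_bigr => i _; rewrite rmorphXn.
Qed.

Lemma mmap_eq n (k A : nzRingType) (f f' : k -> A) (h h' : 'I_n -> A) p :
  f =1 f' -> h =1 h' -> mmap f h p = mmap f' h' p.
Proof.
move=> eqf eqh; apply: eq_bigr => m _; rewrite eqf; congr (_ * _).
exact: mmap1_eq.
Qed.

Lemma rmorph_shear (A B : comNzRingType) (f : {rmorphism A -> B}) x y z a b x' y' z' a' b' :
  f x = x' - a' * y' - b' * z' -> f y = y' -> f z = z' -> f a = a' -> f b = b' ->
  f (x + a * y + b * z) = x'.
Proof. by move=> fx fy fz fa fb; rewrite !rmorphD !rmorphM fx fy fz fa fb; ring. Qed.

Lemma rmorph_unshear (A B : comNzRingType) (f : {rmorphism A -> B}) x y z a b x' y' z' a' b' :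
  f x = x' + b' * z' -> f y = y' -> f z = z' -> f a = a' -> f b = b' ->
  f (x - a * y - b * z) = x' - a' * y'.
Proof. by move=> fx fy fz fa fb; rewrite !rmorphB !rmorphM fx fy fz fa fb; ring. Qed.

(** * A linear change of coordinates *)

Section ShearedCoordinates.
Variables (k : fieldType) (m : nat) (c c' : 'I_m -> k).
Local Notation R := {mpoly k[m]}.
Local Notation A := {mpoly k[m.+2]}.

Definition var_x (i : 'I_m) : A := 'X_(widen (widen i)).
Definition var_y : A := 'X_(widen ord_max).
Definition var_z : A := 'X_ord_max.

Definition shear_C : {rmorphism k -> {poly {poly R}}} :=
  polyC \o polyC \o @mpolyC m k.

(** The variables of [R] stand for the linear forms [x_i - c'_i y - c_i z], the inner ['X] for [y]
    and the outer one for [z]. *)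
Definition shear : {rmorphism A -> {poly {poly R}}} :=
  mmap shear_C
    (point_rcons (point_rcons
      (fun i => (('X_i)%:P + (c' i)%:MP%:P * 'X)%:P + shear_C (c i) * 'X) 'X%:P) 'X).

Definition unshear0 : {rmorphism R -> A} :=
  mmap (@mpolyC _ k) (fun i => var_x i - (c' i)%:MP * var_y - (c i)%:MP * var_z).

Definition horner_rmorph (S B : comNzRingType) (f : {rmorphism S -> B}) (b : B) :
  {rmorphism {poly S} -> B} := horner_eval b \o map_poly f.

Lemma horner_rmorphC (S B : comNzRingType) (f : {rmorphism S -> B}) (b : B) x :
  horner_rmorph f b x%:P = f x.
Proof. by rewrite /= /horner_eval map_polyC hornerC. Qed.

Lemma horner_rmorphX (S B : comNzRingType) (f : {rmorphism S -> B}) (b : B) :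
  horner_rmorph f b 'X = b.
Proof. by rewrite /= /horner_eval map_polyX hornerX. Qed.

Definition unshear : {rmorphism {poly {poly R}} -> A} :=
  horner_rmorph (horner_rmorph unshear0 var_y) var_z.

Lemma shearC x : shear x%:MP = shear_C x. Proof. by rewrite [LHS]mmapC. Qed.

Lemma shear_x i : shear (var_x i) = (('X_i)%:P + (c' i)%:MP%:P * 'X)%:P + shear_C (c i) * 'X.
Proof. by rewrite [LHS]mmapX mmap1U !point_rcons_widen. Qed.

Lemma shear_y : shear var_y = 'X%:P.
Proof. by rewrite [LHS]mmapX mmap1U point_rcons_widen point_rcons_max. Qed.

Lemma shear_z : shear var_z = 'X.
Proof. by rewrite [LHS]mmapX mmap1U point_rcons_max. Qed.

Lemma unshearC x : unshear x%:P%:P = unshear0 x.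
Proof. by rewrite /unshear !horner_rmorphC. Qed.

Lemma unshear_CC x : unshear (shear_C x) = x%:MP.
Proof. by rewrite /shear_C [X in unshear X]/= unshearC [LHS]mmapC. Qed.

Lemma unshear_y : unshear 'X%:P = var_y.
Proof. by rewrite /unshear horner_rmorphC horner_rmorphX. Qed.

Lemma unshear_z : unshear 'X = var_z.
Proof. by rewrite /unshear horner_rmorphX. Qed.

Lemma unshear_x i : unshear ('X_i)%:P%:P = var_x i - (c' i)%:MP * var_y - (c i)%:MP * var_z.
Proof. by rewrite unshearC [LHS]mmapX mmap1U. Qed.

Lemma shearK : cancel shear unshear.
Proof.
move=> p; suff : unshear \o shear =1 idfun by apply.
apply: mpoly_rmorph_ext => [x|]; first by change (unshear (shear x%:MP) = x%:MP); rewrite shearC unshear_CC.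
move=> i; change (unshear (shear 'X_i) = 'X_i); move: i.
apply: ord_widen_ind => [|]; first by rewrite -/var_z shear_z unshear_z.
apply: ord_widen_ind => [|i]; first by rewrite -/var_y shear_y unshear_y.
change (unshear (shear (var_x i)) = var_x i).
rewrite shear_x polyCD polyCM.
exact: rmorph_shear (unshear_x i) unshear_y unshear_z (unshear_CC _) (unshear_CC _).
Qed.

Lemma unshearK : cancel unshear shear.
Proof.
move=> p; suff : shear \o unshear =1 idfun by apply.
apply: poly_rmorph_ext => [q|]; last first.
  by change (shear (unshear 'X) = 'X); rewrite unshear_z shear_z.
suff : shear \o unshear \o polyC =1 @polyC {poly R} by move=> /(_ q).
apply: poly_rmorph_ext => {q} [q|]; last first.
  by change (shear (unshear 'X%:P) = 'X%:P); rewrite unshear_y shear_y.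
suff : shear \o unshear \o polyC \o polyC =1 @polyC {poly R} \o polyC by move=> /(_ q).
apply: mpoly_rmorph_ext => {q} [x|i].
  by change (shear (unshear (shear_C x)) = shear_C x); rewrite unshear_CC shearC.
change (shear (unshear ('X_i)%:P%:P) = ('X_i)%:P%:P).
rewrite unshear_x (rmorph_unshear (shear_x i) shear_y shear_z (shearC _) (shearC _)).
by rewrite polyCD polyCM addrK.
Qed.

End ShearedCoordinates.

(** The direction [c] comes from a first elimination [a], and [c'] from a second one, [b], among
    forms already sheared by [c]. After the shear, [a] has unit leading coefficient in [z], [b] is
    free of [z] with unit leading coefficient in [y], and [d] is free of both. *)
Lemma elimination_regular3 (k : closedFieldType) n (I : {mpoly k[n]} -> Prop) :
  is_ideal I ->
  (forall m (l : 'I_m -> {mpoly k[n]}), (n < m.+3)%N ->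
     exists2 s : {mpoly k[m]}, s != 0 & I (mmap (@mpolyC _ k) l s)) ->
  exists a b d, [/\ I a, I b, I d & regular3 a b d].
Proof.
case: n I => [|[|m]] I idI elimI; last first.
  pose A := {mpoly k[m.+2]}.
  have [s1 nz1 I1] := elimI m (@var_x k m) (leqnn _).
  have [c [e [nz_e lead1]]] := generic_direction nz1.
  have [s2 nz2 I2] := elimI m (fun i => var_x k i - (c i)%:MP * var_z k m) (leqnn _).
  have [c' [e' [nz_e' lead2]]] := generic_direction nz2.
  have [s3 nz3 I3] :=
    elimI m (fun i => var_x k i - (c' i)%:MP * var_y k m - (c i)%:MP * var_z k m) (leqnn _).
  set a := mmap _ _ s1 in I1; set b := mmap _ _ s2 in I2; set d := mmap _ _ s3 in I3.
  exists a, b, d; split=> //.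
  apply: (regular3_can (shearK c c') (unshearK c c')).
  have shear_b : shear c c' b =
      (mmap (polyC \o @mpolyC m k) (fun i => ('X_i)%:P + (c' i)%:MP%:P * 'X) s2)%:P.
    rewrite rmorph_mmap [RHS](rmorph_mmap polyC); apply: mmap_eq => [x|i] /=.
      exact: shearC.
    change (shear c c' (var_x k i - (c i)%:MP * var_z k m) =
             (('X_i)%:P + (c' i)%:MP%:P * 'X)%:P).
    by rewrite rmorphB rmorphM shearC shear_x shear_z addrK.
  have shear_d : shear c c' d = s3%:P%:P.
    have <- : unshear c c' s3%:P%:P = d by exact: unshearC.
    exact: unshearK.
  rewrite shear_b shear_d; apply: regular_poly3 => //.
    rewrite /a rmorph_mmap.
    have -> : mmap (shear c c' \o @mpolyC _ k) (fun i => shear c c' (var_x k i)) s1 =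
      mmap (polyC \o (polyC \o @mpolyC m k))
        (fun i => (('X_i)%:P + (c' i)%:MP%:P * 'X)%:P
                  + ((polyC \o @mpolyC m k) (c i))%:P * 'X) s1.
      by apply: mmap_eq => [x|i]; [exact: shearC | exact: shear_x].
    by rewrite lead1; apply: rmorph_unit; rewrite unitfE.
  by rewrite (lead2 _ (@mpolyC m k)); apply: rmorph_unit; rewrite unitfE.
(* With at most one variable, elimination over no elements puts a nonzero constant in [I]. *)
all: have [s] := elimI 0%N (fun _ => 0) isT.
all: rewrite (nvar0_mpolyC s) mmapC mpolyC_eq0 => nz_s Is.
all: have I1 : I 1 by rewrite -mpolyC1 -(mulVf nz_s) mpolyCM; apply: idealMl.
all: exists 1, 1, 1; split=> //; split; rewrite ?oner_neq0 //.
all: try by [move=> u w; rewrite !mul1r => ->; exists w; rewrite mul1r].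
all: by move=> g h h'; rewrite !mul1r => ->; exists h, h'; rewrite !mul1r.
Qed.

Lemma codim3_regular3 (k : closedFieldType) (V : vectType k) (Z : V -> Prop)
    (I : polyfun V -> Prop) :
  codim_ge (fun _ : V => True) Z 3 -> is_ideal I -> Defs.subset (zero_set I) Z ->
  exists a b d, [/\ I a, I b, I d & regular3 a b d].
Proof.
move=> codimZ idI subZ; apply: elimination_regular3 => // m l lt_m.
exact: codim3_elimination subZ lt_m.
Qed.

(** * Polynomial and regular functions *)

Section PolynomialFunctions.
Variables (k : fieldType) (V : vectType k).
Implicit Types phi psi : V -> k.

Definition polynomial_fun phi := exists p : polyfun V, forall v, phi v = peval p v.

Lemma polynomial_fun_eq phi psi : phi =1 psi -> polynomial_fun psi -> polynomial_fun phi.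
Proof. by move=> eq_phi [p pE]; exists p => v; rewrite eq_phi. Qed.

Lemma polynomial_fun_const c : polynomial_fun (fun _ => c).
Proof. by exists c%:MP => v; rewrite /peval mevalC. Qed.

Lemma polynomial_funD phi psi :
  polynomial_fun phi -> polynomial_fun psi -> polynomial_fun (fun v => phi v + psi v).
Proof. by move=> [p pE] [q qE]; exists (p + q) => v; rewrite /peval rmorphD /= pE qE. Qed.

Lemma polynomial_funM phi psi :
  polynomial_fun phi -> polynomial_fun psi -> polynomial_fun (fun v => phi v * psi v).
Proof. by move=> [p pE] [q qE]; exists (p * q) => v; rewrite /peval rmorphM /= pE qE. Qed.

Lemma polynomial_fun_sum (I : Type) (r : seq I) (F : I -> V -> k) :
  (forall i, polynomial_fun (F i)) -> polynomial_fun (fun v => \sum_(i <- r) F i v).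
Proof.
move=> polF; elim: r => [|i r IHr].
  by apply: polynomial_fun_eq (polynomial_fun_const 0) => v; rewrite big_nil.
by apply: polynomial_fun_eq (polynomial_funD (polF i) IHr) => v; rewrite big_cons.
Qed.

Lemma polynomial_fun_coords i : polynomial_fun (fun v : V => coords v i).
Proof. by exists 'X_i => v; rewrite /peval mevalXU. Qed.

Lemma coords_expand (v : V) : v = \sum_i coords v i *: (vbasis {:V})`_i.
Proof. by rewrite {1}(coord_vbasis (memvf v)). Qed.

End PolynomialFunctions.

Section PolynomialMaps.
Variables (k : fieldType) (V N : vectType k).

Lemma MorP (F : V -> N) : Mor F <-> forall i, polynomial_fun (fun v => coords (F v) i).
Proof.
split=> [[P FE] i|polF].
  by exists (P i) => v; rewrite FE; exact: (coords_point_of (fun j => peval (P j) v)).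
have ex_P i : {p : polyfun V | forall v, coords (F v) i = peval p v}.
  by apply: constructive_indefinite_description; exact: polF.
exists (fun i => sval (ex_P i)) => v; rewrite [LHS]coords_expand.
by apply: eq_bigr => i _; rewrite (svalP (ex_P i)).
Qed.

Lemma Mor_linear_fun (F : V -> N) (g : N -> k) :
  (forall a x y, g (a *: x + y) = a * g x + g y) -> Mor F ->
  polynomial_fun (fun v => g (F v)).
Proof.
move=> lin_g /MorP polF; pose b := vbasis {:N}.
have g0 : g 0 = 0.
  by have /eqP := lin_g 1 0 0; rewrite scale1r addr0 mul1r -subr_eq subrr eq_sym => /eqP.
apply: (@polynomial_fun_eq _ _ _ (fun v => \sum_i coords (F v) i * g b`_i)) => [v|].
  rewrite [in LHS](coords_expand (F v)).
  elim: (index_enum _) => [|i r IHr]; first by rewrite !big_nil g0.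
  by rewrite !big_cons lin_g IHr.
by apply: polynomial_fun_sum => i; apply: polynomial_funM => //; apply: polynomial_fun_const.
Qed.

Lemma polynomial_fun_comp (F : V -> N) (q : polyfun N) :
  Mor F -> polynomial_fun (fun v => peval q (F v)).
Proof.
move=> /MorP polF.
have ex_P i : {p : polyfun V | forall v, coords (F v) i = peval p v}.
  by apply: constructive_indefinite_description; exact: polF.
exists (mmap (@mpolyC _ k) (fun i => sval (ex_P i)) q) => v.
rewrite /peval (rmorph_mmap (meval (coords v))).
by apply: mmap_eq => [c|i] /=; [rewrite mevalC | exact: (svalP (ex_P i))].
Qed.

End PolynomialMaps.

(** * Density and Hartogs extension *)

Section Density.
Variables (k : closedFieldType) (V : vectType k) (Omega : V -> Prop).
Hypothesis codim3 : codim_ge (fun _ : V => True) (fun v => ~ Omega v) 3.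

(** The principal ideal of [h] has no zero in [Omega], so it contains a regular pair [a = h * a'],
    [b = h * b']. From [a * b' = b * a'] follows [b' = b * t = h * b' * t], and [b'] cancels. *)
Lemma nonvanishing_unit (h : polyfun V) :
  (forall v, Omega v -> peval h v != 0) -> exists t, h * t = 1.
Proof.
move=> nz_h; pose I (x : polyfun V) := exists y, x = h * y.
have idI : is_ideal I.
  split.
  - by exists 0; rewrite mulr0.
  - by move=> _ _ [x ->] [y ->]; exists (x + y); rewrite mulrDr.
  - by move=> a _ [x ->]; exists (a * x); rewrite mulrCA.
have [v hv0 Ov|a [b [d [[a' aE] [b' bE] _ [_ nz_b reg2 _]]]]] := codim3_regular3 codim3 idI.
  by have := nz_h v Ov; rewrite (hv0 h) ?eqxx //; exists 1; rewrite mulr1.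
have [|t tE] := reg2 b' a'; first by rewrite aE bE mulrAC.
exists t; have nz_b' : b' != 0 by apply: contraNneq nz_b => b0; rewrite bE b0 mulr0.
by apply: (mulfI nz_b'); rewrite mulr1 [RHS]tE bE; ring.
Qed.

(** If [f] is nonzero at [x], then [f / f(x) - 1] is nowhere zero on [Omega], hence a unit, yet it
    vanishes at [x]. *)
Lemma polynomial_density (f : polyfun V) :
  (forall v, Omega v -> peval f v = 0) -> f = 0.
Proof.
move=> f0; apply: mpoly_meval_inj => x; rewrite meval0; apply/eqP/negPn/negP => nz_fx.
have [v Ov|t] := @nonvanishing_unit ((f.@[x])^-1 *: f - 1).
  by rewrite /peval rmorphB /= mevalZ [X in _ * X]f0 // meval1 mulr0 sub0r oppr_eq0 oner_eq0.
move/(congr1 (meval x)); rewrite rmorphM rmorphB /= mevalZ meval1 mulVf // subrr mul0r.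
by move/esym/eqP; rewrite oner_eq0.
Qed.

Lemma polynomial_density2 (f g : polyfun V) :
  (forall v, Omega v -> peval f v = peval g v) -> f = g.
Proof.
move=> eq_fg; apply/eqP; rewrite -subr_eq0; apply/eqP/polynomial_density => v Ov.
by rewrite /peval rmorphB /= [X in X - _]eq_fg // subrr.
Qed.

(** The denominators of [phi] form an ideal without zeros in [Omega]. For a regular pair [a, b] of
    them, [a * Pb = b * Pa] shows that [b] divides [Pb], and the quotient extends [phi]. *)
Lemma hartogs (phi : V -> k) :
  (forall x, Omega x -> exists P q : polyfun V, peval q x != 0 /\
     forall y, Omega y -> peval q y != 0 -> phi y = (peval q y)^-1 * peval P y) ->
  exists T : polyfun V, forall v, Omega v -> phi v = peval T v.
Proof.
move=> reg_phi.
pose Q (q : polyfun V) := exists P, forall v, Omega v -> peval q v * phi v = peval P v.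
have idQ : is_ideal Q.
  split.
  - by exists 0 => v _; rewrite /peval !rmorph0 mul0r.
  - move=> x y [P PE] [P' PE']; exists (P + P') => v Ov.
    by rewrite /peval !rmorphD /= mulrDl [X in X + _]PE // [X in _ + X]PE'.
  - move=> a x [P PE]; exists (a * P) => v Ov.
    by rewrite /peval !rmorphM /= -mulrA [X in _ * X]PE.
have locQ x : Omega x -> exists2 q, Q q & peval q x != 0.
  move=> Ox; have [P [q [nz_q qE]]] := reg_phi x Ox.
  (* The extra factor [q] makes the identity hold also where [q] vanishes and the local formula says
     nothing. *)
  exists (q * q); last by rewrite /peval rmorphM mulf_neq0.
  exists (q * P) => v Ov; rewrite /peval !rmorphM /= -!/(peval _ v).
  have [->|nz_qv] := eqVneq (peval q v) 0; first by rewrite !mul0r.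
  by rewrite qE // mulrA mulfK // mulrC.
have [v Qv Ov|a [b [d [[Pa PaE] [Pb PbE] _ [nz_a nz_b reg2 _]]]]] := codim3_regular3 codim3 idQ.
  by have [q Qq] := locQ v Ov; rewrite (Qv q Qq) eqxx.
have cross q P q' P' : (forall v, Omega v -> peval q v * phi v = peval P v) ->
    (forall v, Omega v -> peval q' v * phi v = peval P' v) -> q * P' = q' * P.
  move=> qE qE'; apply: polynomial_density2 => v Ov.
  by rewrite /peval !rmorphM /= -!/(peval _ v) -qE // -qE' // mulrCA.
have [T PbT] := reg2 _ _ (cross _ _ _ _ PaE PbE).
exists T => v Ov; have [q [P qE] nz_q] := locQ v Ov.
have PT : P = q * T.
  by apply: (mulfI nz_b); rewrite (cross _ _ _ _ PbE qE) PbT mulrCA.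
by apply: (mulfI nz_q); rewrite qE // PT /peval rmorphM.
Qed.

End Density.

(** * Lifting through a matrix with free kernel *)

(* When the rank stays the same, inverting [M] at [M0] solves [w *m M = c] by
   Cramer's rule near [M0]. *)
Lemma cramer_near (k : fieldType) p q (M0 M : 'M[k]_(p, q)) (c : 'rV[k]_q)
    (S := M *m pinvmx M0 + (1%:M - M0 *m pinvmx M0)) :
  \rank (kermx M) = \rank (kermx M0) -> S \in unitmx -> (c <= M)%MS ->
  \det S *: c = c *m pinvmx M0 *m \adj S *m M.
Proof.
move=> eq_rk uS /submxP[w cE].
set H := 1%:M - M0 *m pinvmx M0 in S uS *.
have HM0 : (H <= kermx M0)%MS.
  by apply/sub_kermxP; rewrite mulmxBl mul1mx mulmxKpV // subrr.
have KS : kermx M *m S = kermx M *m H by rewrite mulmxDr mulmxA mulmx_ker mul0mx add0r.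
(* [S] maps the kernel of [M] into the row space of [H]; it is invertible and the kernels have equal
   rank, so it maps onto it. *)
have HKS : (H <= kermx M *m S)%MS.
  have leKS : (kermx M *m S <= H)%MS by rewrite KS submxMl.
  rewrite -(mxrank_leqif_sup leKS) eqn_leq mxrankS //=.
  by rewrite (mxrankMfree _ _) ?row_free_unit // eq_rk mxrankS.
have HSM : H *m invmx S *m M = 0.
  have /submxP[X ->] := HKS.
  by rewrite mulmxA mulmxK // -mulmxA mulmx_ker mulmx0.
have adjE : \adj S = \det S *: invmx S by rewrite /invmx uS scalerA mulrV ?scale1r //.
rewrite adjE -scalemxAr -scalemxAl; congr (_ *: _).
have -> : c *m pinvmx M0 = w *m S - w *m H by rewrite cE -mulmxBr /S addrK -mulmxA.
by rewrite mulmxBl mulmxBl mulmxK // -cE -!mulmxA (mulmxA H) HSM mulmx0 subr0.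
Qed.

Section Lifting.
Variables (k : closedFieldType) (V : vectType k) (Omega : V -> Prop).
Hypothesis codim3 : codim_ge (fun _ : V => True) (fun v => ~ Omega v) 3.

Local Notation A := (polyfun V).

Definition mxeval m n (v : V) (M : 'M[A]_(m, n)) : 'M[k]_(m, n) :=
  map_mx (meval (coords v)) M.

Lemma mxevalM m n l v (M : 'M[A]_(m, n)) (N : 'M_(n, l)) :
  mxeval v (M *m N) = mxeval v M *m mxeval v N.
Proof. exact: map_mxM. Qed.

Lemma mxevalZ m n v a (M : 'M[A]_(m, n)) : mxeval v (a *: M) = peval a v *: mxeval v M.
Proof. exact: map_mxZ. Qed.

Lemma mxeval_density m n (M N : 'M[A]_(m, n)) :
  (forall v, Omega v -> mxeval v M = mxeval v N) -> M = N.
Proof.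
move=> eqMN; apply/matrixP => i j; apply: (polynomial_density2 codim3) => v Ov.
by have /matrixP/(_ i j) := eqMN v Ov; rewrite !mxE.
Qed.

Variables (p q r : nat) (M : 'M[A]_(p, q)) (B : 'M[A]_(r, p)) (c : 'rV[A]_q).
Hypothesis rank_ker : forall v, Omega v -> \rank (kermx (mxeval v M)) = r.
Hypothesis BM0 : B *m M = 0.
Hypothesis B_inj : forall g : 'rV[A]_r, g *m B = 0 -> g = 0.
Hypothesis syzygy : forall F : 'rV[A]_p, F *m M = 0 -> exists g : 'rV[A]_r, F = g *m B.
Hypothesis c_in : forall v, Omega v -> (mxeval v c <= mxeval v M)%MS.

Definition denominator (a : A) := exists F : 'rV[A]_p, a *: c = F *m M.

Lemma denominator_ideal : is_ideal denominator.
Proof.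
split.
- by exists 0; rewrite scale0r mul0mx.
- by move=> a b [F FE] [F' FE']; exists (F + F'); rewrite scalerDl mulmxDl FE FE'.
- by move=> a b [F FE]; exists (a *: F); rewrite -scalerA -scalemxAl FE.
Qed.

(** A pseudo-inverse of the matrix at [v0], frozen as a constant, makes [S] polynomial;
    [cramer_near] then applies at every point of [Omega] where [S] is invertible. *)
Lemma denominator_local v0 : Omega v0 -> exists2 a, denominator a & peval a v0 != 0.
Proof.
move=> Ov0; set M0 := mxeval v0 M; pose G := pinvmx M0; pose H := 1%:M - M0 *m G.
pose C m n (X : 'M[k]_(m, n)) : 'M[A]_(m, n) := map_mx (@mpolyC _ k) X.
have evC m n (X : 'M[k]_(m, n)) v : mxeval v (C _ _ X) = X.
  by apply/matrixP => i j; rewrite !mxE mevalC.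
pose S := M *m C _ _ G + C _ _ H.
have evS v : mxeval v S = mxeval v M *m G + H.
  by rewrite -[in RHS](evC _ _ G v) -[in RHS](evC _ _ H v) /mxeval -map_mxM -map_mxD.
have ev_det v : peval (\det S) v = \det (mxeval v S) by rewrite [RHS]det_map_mx.
(* At [v0] the matrix [S] is the identity. The second factor makes both sides vanish where [S] is
   singular. *)
exists (\det S * \det S); last first.
  have := ev_det v0; rewrite evS -/M0 addrC subrK det1 /peval => detS.
  by rewrite rmorphM /= detS mulr1 oner_neq0.
exists (\det S *: (c *m C _ _ G *m \adj S)); apply: mxeval_density => v Ov.
have ev_adj : mxeval v (\adj S) = \adj (mxeval v S) by exact: map_mx_adj.
have evM : peval (\det S * \det S) v = peval (\det S) v * peval (\det S) v.
  exact: rmorphM.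
rewrite mxevalZ evM !mxevalM mxevalZ !mxevalM ev_adj evC -scalerA -scalemxAl.
have [->|nz_S] := eqVneq (peval (\det S) v) 0; first by rewrite !scale0r.
congr (_ *: _); rewrite ev_det evS in nz_S *.
by apply: cramer_near; rewrite ?c_in ?rank_ker // unitmxE unitfE.
Qed.

(* The difference of two local solutions [Fa / a] and [Fb / b] is a Cech
   cocycle of the trivial bundle [im B]; regularity of [(a, b, d)] splits it. *)
Lemma lifting : exists F : 'rV[A]_p, c = F *m M.
Proof.
have sub0 : Defs.subset (zero_set denominator) (fun v => ~ Omega v).
  by move=> v Qv Ov; have [a Da] := denominator_local Ov; rewrite (Qv a Da) eqxx.
have [a [b [d [[Fa FaE] [Fb FbE] [Fd FdE] [nz_a nz_b reg2 reg3]]]]] :=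
  codim3_regular3 codim3 denominator_ideal sub0.
have cocycle x y Fx Fy : x *: c = Fx *m M -> y *: c = Fy *m M ->
    exists g : 'rV[A]_r, y *: Fx - x *: Fy = g *m B.
  move=> xE yE; apply: syzygy; rewrite mulmxBl -!scalemxAl -xE -yE !scalerA mulrC.
  by rewrite subrr.
have [g1 g1E] := cocycle _ _ _ _ FaE FbE.
have [g2 g2E] := cocycle _ _ _ _ FaE FdE.
have [g3 g3E] := cocycle _ _ _ _ FbE FdE.
(* This is the cocycle relation, checked after multiplication by the injective [B]. *)
have g_eq : d *: g1 = a *: (- g3) + b *: g2.
  apply/eqP; rewrite -subr_eq0; apply/eqP/B_inj.
  rewrite mulmxBl mulmxDl -!scalemxAl mulNmx -g1E -g2E -g3E.
  by apply/matrixP => i j; rewrite !mxE; ring.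
have ex_e j : {e : A * A | g1 0 j = a * e.1 + b * e.2}.
  apply: constructive_indefinite_description.
  have /matrixP/(_ 0 j) := g_eq; rewrite !mxE => /reg3[e [e' eE]].
  by exists (e, e').
pose e : 'rV[A]_r := \row_j (sval (ex_e j)).1.
pose e' : 'rV[A]_r := \row_j (sval (ex_e j)).2.
have g1_split : g1 = a *: e + b *: e'.
  by apply/rowP => j; rewrite !mxE; exact: (svalP (ex_e j)).
(* The corrected local solutions agree as fractions over [b] and [a]; regularity makes the common
   value polynomial. *)
have glue j : a * (Fb + e *m B) 0 j = b * (Fa - e' *m B) 0 j.
  move: g1E; rewrite g1_split mulmxDl -!scalemxAl; move: (e *m B) (e' *m B) => u u'.
  move=> /rowP/(_ j); rewrite !mxE => h.
  have -> : a * (Fb 0 j + u 0 j) = a * u 0 j + b * u' 0 j + (a * Fb 0 j - b * u' 0 j) by ring.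
  by rewrite -h; ring.
have ex_t j : {t | (Fb + e *m B) 0 j = b * t}.
  by apply: constructive_indefinite_description; apply: reg2 (glue j).
pose t := \row_j sval (ex_t j); exists t.
have tE : Fb + e *m B = b *: t.
  by apply/rowP => j; apply: etrans (svalP (ex_t j)) _; rewrite [RHS]mxE [t 0 j]mxE.
have tM : b *: (t *m M) = b *: c.
  by rewrite scalemxAl -tE mulmxDl -mulmxA BM0 mulmx0 addr0.
apply/rowP => j; have /rowP/(_ j) := tM; move: (t *m M) => u; rewrite !mxE.
by move/(mulfI nz_b).
Qed.
End Lifting.

(** * The moment map *)

Lemma linear_combination (R : nzRingType) (U W : lmodType R) (f : U -> W)
    (I : Type) (s : seq I) (a : I -> R) (x : I -> U) :
  linear f -> f (\sum_(i <- s) a i *: x i) = \sum_(i <- s) a i *: f (x i).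
Proof.
move=> lin_f; have f0 : f 0 = 0.
  by have /eqP := lin_f 1 0 0; rewrite scaler0 addr0 scale1r -subr_eq subrr eq_sym => /eqP.
elim: s => [|i s IHs]; first by rewrite !big_nil f0.
by rewrite !big_cons lin_f IHs.
Qed.

Section Coordinates.
Variables (k : fieldType) (N : vectType k).

Definition row_of (x : N) : 'rV[k]_(\dim {:N}) := \row_i coords x i.
Definition of_row (u : 'rV[k]_(\dim {:N})) : N := point_of (u 0).

Lemma of_rowK : cancel of_row row_of.
Proof. by move=> u; apply/rowP => i; rewrite mxE coords_point_of. Qed.

Lemma row_ofK : cancel row_of of_row.
Proof.
by move=> x; rewrite [RHS]coords_expand; apply: eq_bigr => i _; rewrite mxE.
Qed.

Lemma row_of_is_linear : linear row_of.
Proof. by move=> a x y; apply/rowP => i; rewrite !mxE /coords linearP. Qed.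

End Coordinates.

Section MorphismTools.
Variables (k : fieldType) (V : vectType k).

Lemma Mor_const (N : vectType k) (x : N) : Mor (fun _ : V => x).
Proof. by apply/MorP => i; apply: polynomial_fun_const. Qed.

Lemma Mor_linear (N : vectType k) (f : V -> N) : linear f -> Mor f.
Proof.
move=> lin_f; apply/MorP => i.
apply: (@Mor_linear_fun _ V V id (fun v => coords (f v) i)).
  by move=> a x y; rewrite lin_f /coords linearP.
by apply/MorP => j; apply: polynomial_fun_coords.
Qed.

(** The basis chosen on the product need not come from those of the factors, so the pair is split as
    [(v, 0) + (0, F v)], where coordinates are linear forms in [v] and in [F v]. *)
Lemma Mor_pair (N : vectType k) (F : V -> N) :
  Mor F -> Mor (fun v => (v, F v) : (V * N)%type).
Proof.
move=> MF; apply/MorP => i.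
apply: (@polynomial_fun_eq _ _ _
  (fun v => coords ((v, 0) : (V * N)%type) i + coords ((0, F v) : (V * N)%type) i)) => [v|].
  rewrite /coords -linearD /=; congr (coord _ _ _).
  by congr pair; rewrite /= ?addr0 ?add0r.
apply: polynomial_funD.
  apply: (@Mor_linear_fun _ V V id (fun v => coords ((v, 0) : (V * N)%type) i)).
    move=> a x y; rewrite /coords -linearP /=; congr (coord _ _ _).
    by congr pair; rewrite /= ?scaler0 ?addr0.
  by apply/MorP => j; apply: polynomial_fun_coords.
apply: (@Mor_linear_fun _ V N F (fun x => coords ((0, x) : (V * N)%type) i)) => //.
move=> a x y; rewrite /coords -linearP /=; congr (coord _ _ _).
by congr pair; rewrite /= ?scaler0 ?addr0.
Qed.

Lemma mxeval_lift (X : V -> Prop) m n (F : V -> 'M[k]_(m, n)) :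
  (forall i j, exists P : polyfun V, forall v, X v -> F v i j = peval P v) ->
  exists M : 'M[polyfun V]_(m, n), forall v, X v -> map_mx (meval (coords v)) M = F v.
Proof.
move=> polF.
have ex_P i j : {P : polyfun V | forall v, X v -> F v i j = peval P v}.
  by apply: constructive_indefinite_description.
exists (\matrix_(i, j) sval (ex_P i j)) => v Xv; apply/matrixP => i j.
by rewrite !mxE (svalP (ex_P i j)).
Qed.

End MorphismTools.

(** Pulled back along the graph of [F], local quotients of polynomials remain such, and [hartogs]
    extends each coordinate. *)
Lemma regular_on_graph (k : closedFieldType) (V N1 N2 : vectType k) (Omega : V -> Prop)
    (X : V * N1 -> Prop) (Phi : V * N1 -> N2) (F : V -> N1) :
  codim_ge (fun _ : V => True) (fun v => ~ Omega v) 3 ->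
  regular_on X Phi -> Mor F -> (forall v, Omega v -> X (v, F v)) ->
  exists T : polymap V N2, forall v, Omega v -> Phi (v, F v) = mapeval T v.
Proof.
move=> codim3 regPhi MF XF.
have ex_T i : {T : polyfun V | forall v, Omega v -> coords (Phi (v, F v)) i = peval T v}.
  apply: constructive_indefinite_description; apply: (hartogs codim3) => x Ox.
  have [P [q [nz_q qE]]] := regPhi _ (XF x Ox).
  have [P' P'E] := polynomial_fun_comp (P i) (Mor_pair MF).
  have [q' q'E] := polynomial_fun_comp q (Mor_pair MF).
  exists P', q'; rewrite -q'E; split=> // y Oy; rewrite -q'E -P'E => nz_qy.
  rewrite qE //; last exact: XF.
  by rewrite {1}/coords linearZ /= -/(coords _ i) [coords _ i]coords_point_of.
exists (fun i => sval (ex_T i)) => v Ov; rewrite [LHS]coords_expand.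
by apply: eq_bigr => i _; rewrite (svalP (ex_T i)).
Qed.

Section MomentMap.
Variables (k : closedFieldType) (W : vectType k) (G : affAlgGroup W) (V : vectType k).
Variable rho : ratModule G V.

Local Notation N := (dual V).
Local Notation L := (dual (lie_type G)).

Lemma mu_linear_r v : linear (mu rho v).
Proof.
by move=> a x y; apply/lfunP => z; rewrite !(muE, add_lfunE, scale_lfunE).
Qed.

Lemma mu_linear_l eta : linear (fun v => mu rho v eta).
Proof.
move=> a x y; apply/lfunP => z; rewrite !(muE, add_lfunE, scale_lfunE) /lact.
by rewrite !linearP.
Qed.

Definition mu_mx (v : V) : 'M[k]_(\dim {:N}, \dim {:L}) :=
  \matrix_i row_of (mu rho v (vbasis {:N})`_i).

Lemma row_of_mu v eta : row_of (mu rho v eta) = row_of eta *m mu_mx v.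
Proof.
rewrite {1}(coords_expand eta) (linear_combination _ _ _ (mu_linear_r v)).
rewrite (linear_combination _ _ _ (@row_of_is_linear _ _)) mulmx_sum_row.
by apply: eq_bigr => i _; rewrite rowK mxE.
Qed.

Lemma mu_mx_lift : exists M : 'M[polyfun V]_(\dim {:N}, \dim {:L}),
  forall v, mxeval v M = mu_mx v.
Proof.
have [|M ME] := @mxeval_lift _ _ (fun _ : V => True) _ _ mu_mx.
  move=> i j; have /MorP/(_ j)[P PE] := Mor_linear (mu_linear_l (vbasis {:N})`_i).
  by exists P => v _; rewrite !mxE PE.
by exists M => v; apply: ME.
Qed.

Lemma row_lift (U : vectType k) (F : V -> U) : Mor F ->
  exists c : 'rV[polyfun V]_(\dim {:U}), forall v, mxeval v c = row_of (F v).
Proof.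
move=> /MorP MF.
have [|c cE] := @mxeval_lift _ _ (fun _ : V => True) _ _ (fun v => row_of (F v)).
  by move=> i j; have [P PE] := MF j; exists P => v _; rewrite mxE PE.
by exists c => v; apply: cE.
Qed.

Lemma Mor_of_row (U : vectType k) (c : 'rV[polyfun V]_(\dim {:U})) :
  Mor (fun v => of_row (mxeval v c)).
Proof.
apply/MorP => i; exists (c 0 i) => v.
by rewrite /of_row coords_point_of mxE.
Qed.

Lemma Mor_psi_hat (F : V -> N) : Mor F -> Mor (psi_hat rho F).
Proof.
move=> MF; have [M ME] := mu_mx_lift; have [f fE] := row_lift MF.
have [P PE] := Mor_of_row (f *m M); exists P => v.
by rewrite -PE mxevalM fE ME -row_of_mu row_ofK.
Qed.

(** The trivialization supplies what [lifting] asks for: [Phi] yields the polynomial frame [B], and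
    [Psi] the coordinates of syzygies in that frame. *)
Lemma trivial_kernel_lifting (E_trivial : trivial_bundle (Vreg rho) (Epsi rho))
    (codim3 : codim_ge (fun _ : V => True) (fun v => ~ Vreg rho v) 3)
    (calF : V -> L) :
  Mor calF -> (forall v, Vreg rho v -> in_mu rho v (calF v)) ->
  exists2 F : V -> N, Mor F & forall v, calF v = mu rho v (F v).
Proof.
move=> McalF calF_in; have [M ME] := mu_mx_lift; have [c cE] := row_lift McalF.
have [r [Phi [Psi [regPhi regPsi linPhi PhiK PsiK]]]] := E_trivial.
(* The images under [Phi] of the standard basis vectors extend polynomially to [V]. *)
have ex_B j : {T : polymap V N | forall v, Vreg rho v ->
    Phi (v, delta_mx 0 j) = mapeval T v}.
  apply: constructive_indefinite_description.
  exact: (regular_on_graph codim3 regPhi (Mor_const _ (delta_mx 0 j))).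
pose B : 'M[polyfun V]_(r, \dim {:N}) := \matrix_(j, i) sval (ex_B j) i.
have rowPhi v (u : 'rV_r) : Vreg rho v -> row_of (Phi (v, u)) = u *m mxeval v B.
  move=> Ov; rewrite {1}[u]row_sum_delta (linear_combination _ _ _ (linPhi v Ov)).
  rewrite (linear_combination _ _ _ (@row_of_is_linear _ _)) mulmx_sum_row.
  apply: eq_bigr => j _; congr (_ *: _); apply/rowP => i; rewrite !mxE.
  by rewrite (svalP (ex_B j)) // /mapeval [LHS]coords_point_of.
have muPhi v u : Vreg rho v -> mu rho v (Phi (v, u)) = 0.
  by move=> Ov; have [[]] := PhiK v u Ov.
have row_of0 (U : vectType k) : row_of (0 : U) = 0.
  by apply/rowP => i; rewrite !mxE /coords linear0.
have B_free v : Vreg rho v -> row_free (mxeval v B).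
  move=> Ov; apply: inj_row_free => u uB0.
  have Phi_eq : Phi (v, u) = Phi (v, 0).
    by apply: (can_inj (@row_ofK _ _)); rewrite !rowPhi // uB0 mul0mx.
  by have [_ <-] := PhiK v u Ov; rewrite Phi_eq; have [_ ->] := PhiK v 0 Ov.
have BM0 v : Vreg rho v -> mxeval v B *m mu_mx v = 0.
  move=> Ov; apply/row_matrixP => j; rewrite row_mul rowE -rowPhi //.
  by rewrite -row_of_mu muPhi // row_of0 row0.
have B_ker v u : Vreg rho v -> u *m mu_mx v = 0 ->
    u = Psi (v, of_row u) *m mxeval v B.
  move=> Ov uM0; have Eu : Epsi rho (v, of_row u).
    split=> //; apply: (can_inj (@row_ofK _ _)).
    by rewrite row_of_mu of_rowK uM0 row_of0.
  by rewrite -rowPhi // PsiK // of_rowK.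
have [|||||F FE] := @lifting k V (Vreg rho) codim3 _ _ r M B c.
- move=> v Ov; rewrite ME -(eqP (B_free v Ov)).
  apply/eqP; rewrite eqn_leq !mxrankS //; first by apply/sub_kermxP/BM0.
  apply/row_subP => i; rewrite (B_ker v (row i _) Ov) ?submxMl //.
  by rewrite -row_mul mulmx_ker row0.
- apply: (mxeval_density codim3) => v Ov; rewrite mxevalM ME BM0 //.
  by apply/matrixP => i j; rewrite !mxE meval0.
- move=> g gB0; apply: (mxeval_density codim3) => v Ov.
  apply: (row_free_inj (B_free v Ov)).
  by rewrite -!mxevalM gB0 mul0mx.
(* A syzygy is a section of [Epsi] over [Vreg]; its coordinates under [Psi] extend to
   polynomials. *)
- move=> f fM0.
  have fv0 v : mxeval v f *m mu_mx v = 0.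
    by rewrite -ME -mxevalM fM0; apply/matrixP => i j; rewrite !mxE meval0.
  have [v Ov|T TE] := regular_on_graph codim3 regPsi (Mor_of_row f).
    by split=> //; apply: (can_inj (@row_ofK _ _)); rewrite row_of_mu of_rowK fv0 row_of0.
  have [g gE] : exists g : 'rV[polyfun V]_r, forall v, True -> mxeval v g = mapeval T v.
    apply: mxeval_lift => i j.
    have [||P PE] := @Mor_linear_fun _ V _ (mapeval T) (fun u : 'rV_r => u i j).
    - by move=> a x y; rewrite !mxE.
    - by exists T.
    by exists P => v _; apply: PE.
  exists g; apply: (mxeval_density codim3) => v Ov.
  by rewrite mxevalM gE // -TE // -B_ker.
- move=> v Ov; have [eta etaE] := calF_in v Ov.
  by rewrite cE ME etaE row_of_mu submxMl.
exists (fun v => of_row (mxeval v F)); first exact: Mor_of_row.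
move=> v; apply: (can_inj (@row_ofK _ _)).
by rewrite row_of_mu of_rowK -cE FE mxevalM ME.
Qed.

End MomentMap.

Theorem proposition3p2 (k : closedFieldType) (k_char0 : [pchar k] =i pred0)
    (W : vectType k) (G : affAlgGroup W) (G_connected : ag_connected G)
    (V : vectType k) (rho : ratModule G V)
    (E_trivial : trivial_bundle (Vreg rho) (Epsi rho))
    (codim3 : codim_ge (fun _ : V => True) (fun v => ~ Vreg rho v) 3) :
  (forall calF : V -> dual (lie_type G),
     (exists2 F : V -> dual V, Mor F & forall v, calF v = psi_hat rho F v) <->
     (Mor calF /\ forall v, in_mu rho v (calF v))) /\
  (forall calF : V -> dual (lie_type G),
     Mor calF -> (forall v, Vreg rho v -> in_mu rho v (calF v)) ->
     exists2 F : V -> dual V, Mor F & forall v, calF v = mu rho v (F v)).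
Proof.
have lift := @trivial_kernel_lifting _ _ _ _ rho E_trivial codim3.
split=> // calF; split=> [[F MF FE]|[McalF calF_in]]; last exact: lift.
split; last by move=> v; exists (F v); exact: FE.
by have [P PE] := Mor_psi_hat rho MF; exists P => v; rewrite FE.
Qed.
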